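(* Let $\langle\mathcal M,W,F,C\rangle$ be an internal model category. Then the homotopy category $\mathrm{Ho}(\mathcal M)$ and the *homotopy category ${}^*\mathrm{Ho}(\mathcal M)$ are canonically isomorphic (i.e. isomorphic compatibly with the canonical functors from $\mathcal M$ to them).
   Context: **Nonstandard setup.** Fix a hierarchy of universes $\mathcal U_0\in\mathcal U_1\in\mathcal U_2\in\dots$, a set $S$ of individuals with $|S|\ge|\bigcup_n\mathcal U_n|$, its superstructure $\hat S$, and an enlargement $*:\hat S\to\widehat{{}^*S}$ (a superstructure map satisfying the transfer principle and the usual enlargement/concurrence property). The universes $\mathcal U_i$ are considered as subsets of $S$ and hence as elements of $\hat S$; elements of ${}^*\mathcal U_i$ are regarded as internal sets via the enlarged membership relation. An object is internal if it is an element of some ${}^*A$ with $A\in\hat S$. **Model categories.** A (small) model category is a quadruple $\langle\mathcal M,W,F,C\rangle$ with $\mathcal M$ a small category and $W,F,C$ sets of morphisms such that: $\mathcal M$ has all finite limits and colimits; $W,F,C$ contain all identities and are closed under composition; if $fg\in W$ and one of $f,g$ is in $W$, then both are; $W,F,C$ are closed under retracts; for every commutative square $pf=gi$ with $p\in F$, $i\in C$ and ($i\in W$ or $p\in W$) there is $h$ with $hi=f$, $ph=g$; every morphism factors as $pi$ with $p\in F\cap W$, $i\in C$, and as $pi$ with $p\in F$, $i\in C\cap W$. An internal model category (${}^*\mathcal U_1$-small) is a model category with object and morphism sets in ${}^*\mathcal U_1$, internal structure maps and internal $W,F,C$; equivalently an object of the enlargement of the $2$-category of $\mathcal U_1$-small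 model categories. **Homotopy categories.** The homotopy category $\mathrm{Ho}(\mathcal M)$ of a model category $\langle\mathcal M,W,F,C\rangle$ is the localization $\mathcal M[W^{-1}]$ of $\mathcal M$ by $W$. For an internal model category, $\mathrm{Ho}(\mathcal M)$ is the ordinary (external) localization, and ${}^*\mathrm{Ho}(\mathcal M)$ is the notion obtained by transfer: the *localization of $\mathcal M$ by $W$ (where words in morphisms of $\mathcal M$ and formal inverses of elements of $W$ may be of *finite length). Since $\mathcal M\to{}^*\mathrm{Ho}(\mathcal M)$ inverts $W$, it factors uniquely through a canonical functor $\mathrm{Ho}(\mathcal M)\to{}^*\mathrm{Ho}(\mathcal M)$, which is the identity on objects. *)

(* Defs.v *)
From mathcomp Require Import all_boot.
From mathcomp Require Import boolp.
From Stdlib Require List.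

Set Implicit Arguments.
Unset Strict Implicit.
Unset Printing Implicit Defensive.

Record category := Category {
  Ob :> Type;
  Hom : Ob -> Ob -> Type;
  idc : forall a, Hom a a;
  comp : forall a b c, Hom b c -> Hom a b -> Hom a c;
  compA : forall a b c d (h : Hom c d) (g : Hom b c) (f : Hom a b),
    comp h (comp g f) = comp (comp h g) f;
  comp1c : forall a b (f : Hom a b), comp (idc b) f = f;
  compc1 : forall a b (f : Hom a b), comp f (idc a) = f }.

Arguments idc {c0} a : rename.
Notation "g \oc f" := (comp g f) (at level 40, left associativity).

Record functor (C D : category) := Functor {
  fob :> C -> D;
  fmap : forall a b, Hom a b -> Hom (fob a) (fob b);
  fmap1 : forall a, fmap (idc a) = idc (fob a);
  fmapM : forall a b c (g : Hom b c) (f : Hom a b),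
    fmap (g \oc f) = fmap g \oc fmap f }.

Definition functor_id (C : category) : functor C C :=
  @Functor C C id (fun _ _ f => f) (fun _ => erefl) (fun _ _ _ _ _ => erefl).

Section FunctorComp.
Variables (C D E : category) (G : functor D E) (F : functor C D).

Lemma functor_comp_subproof1 a : fmap G (fmap F (idc a)) = idc (G (F a)).
Proof. by rewrite !fmap1. Qed.

Lemma functor_comp_subproofM a b c (g : Hom b c) (f : Hom a b) :
  fmap G (fmap F (g \oc f)) = fmap G (fmap F g) \oc fmap G (fmap F f).
Proof. by rewrite !fmapM. Qed.

Definition functor_comp : functor C E :=
  @Functor C E (fun a => G (F a)) (fun a b f => fmap G (fmap F f))
    functor_comp_subproof1 functor_comp_subproofM.
End FunctorComp.

Definition functor_iso (C D : category) (F : functor C D) : Prop :=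
  exists G : functor D C,
    functor_comp G F = functor_id C /\ functor_comp F G = functor_id D.

Definition mor_class (C : category) := forall a b : C, Hom a b -> Prop.

Definition finite_type (T : Type) : Prop :=
  exists s : list T, forall x, List.In x s.

Definition finite_category (J : category) : Prop :=
  finite_type J /\ forall a b : J, finite_type (Hom a b).

Definition is_cone (J C : category) (D : functor J C) (l : C)
    (p : forall j, Hom l (D j)) : Prop :=
  forall i j (u : Hom i j), fmap D u \oc p i = p j.

Definition has_finite_limits (C : category) : Prop :=
  forall (J : category) (D : functor J C), finite_category J ->
  exists (l : C) (p : forall j, Hom l (D j)), is_cone p /\
    forall (x : C) (q : forall j, Hom x (D j)), is_cone q ->
      exists! h : Hom x l, forall j, p j \oc h = q j.

Definition is_cocone (J C : category) (D : functor J C) (l : C)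
    (p : forall j, Hom (D j) l) : Prop :=
  forall i j (u : Hom i j), p j \oc fmap D u = p i.

Definition has_finite_colimits (C : category) : Prop :=
  forall (J : category) (D : functor J C), finite_category J ->
  exists (l : C) (p : forall j, Hom (D j) l), is_cocone p /\
    forall (x : C) (q : forall j, Hom (D j) x), is_cocone q ->
      exists! h : Hom l x, forall j, h \oc p j = q j.

Section ModelCategory.
Variable M : category.

Definition has_ids (K : mor_class M) : Prop := forall a : M, K _ _ (idc a).

Definition comp_closed (K : mor_class M) : Prop :=
  forall (a b c : M) (g : Hom b c) (f : Hom a b),
    K _ _ g -> K _ _ f -> K _ _ (g \oc f).

Definition two_of_three (K : mor_class M) : Prop :=
  forall (a b c : M) (f : Hom b c) (g : Hom a b),
    K _ _ (f \oc g) -> K _ _ f \/ K _ _ g -> K _ _ f /\ K _ _ g.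

Definition retract_closed (K : mor_class M) : Prop :=
  forall (a b c d : M) (f : Hom a b) (g : Hom c d)
      (i : Hom a c) (r : Hom c a) (j : Hom b d) (s : Hom d b),
    r \oc i = idc a -> s \oc j = idc b ->
    g \oc i = j \oc f -> f \oc r = s \oc g ->
    K _ _ g -> K _ _ f.

Definition lifting (W F C : mor_class M) : Prop :=
  forall (a b x y : M) (i : Hom a b) (p : Hom x y) (f : Hom a x) (g : Hom b y),
    p \oc f = g \oc i -> F _ _ p -> C _ _ i -> W _ _ i \/ W _ _ p ->
    exists h : Hom b x, h \oc i = f /\ p \oc h = g.

Definition factorization (W F C : mor_class M) : Prop :=
  forall (a b : M) (f : Hom a b),
    (exists (x : M) (i : Hom a x) (p : Hom x b),
      [/\ f = p \oc i, F _ _ p, W _ _ p & C _ _ i]) /\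
    (exists (x : M) (i : Hom a x) (p : Hom x b),
      [/\ f = p \oc i, F _ _ p, C _ _ i & W _ _ i]).

Record is_model_category (W F C : mor_class M) : Prop := IsModelCategory {
  mc_lim : has_finite_limits M;
  mc_colim : has_finite_colimits M;
  mc_ids : [/\ has_ids W, has_ids F & has_ids C];
  mc_comp : [/\ comp_closed W, comp_closed F & comp_closed C];
  mc_23 : two_of_three W;
  mc_retract : [/\ retract_closed W, retract_closed F & retract_closed C];
  mc_lift : lifting W F C;
  mc_fact : factorization W F C }.
End ModelCategory.

(* M[W^-1]: words in the morphisms of M and formal inverses of the elements
   of W, modulo the congruence [word_eq] generated by the evident relations. *)

Section Localization.
Variables (M : category) (W : mor_class M).

(* Letters are listed in the order in which the arrows are traversed. *)
Inductive word : M -> M -> Type :=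
| wnil a : word a a
| wfwd a b c : Hom a b -> word b c -> word a c
| wbwd a b c (s : Hom b a) : W s -> word b c -> word a c.

Fixpoint wcat a b c (p : word a b) : word b c -> word a c :=
  match p with
  | wnil _ => fun q => q
  | wfwd _ _ _ f p' => fun q => wfwd f (wcat p' q)
  | wbwd _ _ _ _ Ws p' => fun q => wbwd Ws (wcat p' q)
  end.

Definition wfwd1 a b (f : Hom a b) : word a b := wfwd f (wnil b).
Definition wbwd1 a b (s : Hom a b) (Ws : W s) : word b a := wbwd Ws (wnil a).

Inductive word_eq : forall a b, word a b -> word a b -> Prop :=
| weq_refl a b (p : word a b) : word_eq p p
| weq_sym a b (p q : word a b) : word_eq p q -> word_eq q p
| weq_trans a b (p q r : word a b) : word_eq p q -> word_eq q r -> word_eq p r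
| weq_cat a b c (p p' : word a b) (q q' : word b c) :
    word_eq p p' -> word_eq q q' -> word_eq (wcat p q) (wcat p' q')
| weq_id a : word_eq (wfwd1 (idc a)) (wnil a)
| weq_comp a b c (g : Hom b c) (f : Hom a b) :
    word_eq (wcat (wfwd1 f) (wfwd1 g)) (wfwd1 (g \oc f))
| weq_fb a b (s : Hom a b) (Ws : W s) :
    word_eq (wcat (wfwd1 s) (wbwd1 Ws)) (wnil a)
| weq_bf a b (s : Hom a b) (Ws : W s) :
    word_eq (wcat (wbwd1 Ws) (wfwd1 s)) (wnil b).

Record word_class (a b : M) := WordClass {
  wc :> word a b -> Prop;
  wcP : exists p, wc = word_eq p }.

Definition wclass a b (p : word a b) : word_class a b :=
  @WordClass a b (word_eq p) (ex_intro _ p erefl).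

Lemma wc_inj a b (P Q : word_class a b) : wc P = wc Q -> P = Q.
Proof.
case: P Q => [P hP] [Q hQ] /= e; case: _ / e hQ => hQ.
by congr WordClass; apply: Prop_irrelevance.
Qed.

Lemma wclass_eq a b (p q : word a b) : word_eq p q -> wclass p = wclass q.
Proof.
move=> e; apply: wc_inj; apply: funext => r; apply: propext; split.
- by apply: weq_trans; apply: weq_sym.
- exact: weq_trans.
Qed.

Lemma wclassP a b (P : word_class a b) : exists p, P = wclass p.
Proof. by have [p e] := wcP P; exists p; apply: wc_inj. Qed.

Lemma wcat_subproof a b c (Q : word_class b c) (P : word_class a b) :
  exists r0, (fun r => exists p q, [/\ P p, Q q & word_eq (wcat p q) r])
             = word_eq r0.
Proof.
have [p ->] := wclassP P; have [q ->] := wclassP Q.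
exists (wcat p q); apply: funext => r; apply: propext; split.
- move=> [p' [q' [ep eq]]]; apply: weq_trans; exact: weq_cat.
- by move=> e; exists p, q; split=> //; apply: weq_refl.
Qed.

Definition wc_comp a b c (Q : word_class b c) (P : word_class a b) :
  word_class a c := WordClass (wcat_subproof Q P).

Lemma wc_compE a b c (q : word b c) (p : word a b) :
  wc_comp (wclass q) (wclass p) = wclass (wcat p q).
Proof.
apply: wc_inj; apply: funext => r; apply: propext; split.
- move=> [p' [q' [ep eq]]]; apply: weq_trans; exact: weq_cat.
- by move=> e; exists p, q; split=> //; apply: weq_refl.
Qed.

Lemma wcatA a b c d (p : word a b) (q : word b c) (r : word c d) :
  wcat (wcat p q) r = wcat p (wcat q r).
Proof. by elim: p q => //= {}a {}b e => [f|s Ws] p IH q; rewrite IH. Qed.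

Lemma wcat0 a b (p : word a b) : wcat p (wnil b) = p.
Proof. by elim: p => //= {}a {}b e => [f|s Ws] p ->. Qed.

Lemma wc_compA a b c d (R : word_class c d) (Q : word_class b c)
    (P : word_class a b) :
  wc_comp R (wc_comp Q P) = wc_comp (wc_comp R Q) P.
Proof.
have [p ->] := wclassP P; have [q ->] := wclassP Q; have [r ->] := wclassP R.
by rewrite !wc_compE wcatA.
Qed.

Lemma wc_comp1c a b (P : word_class a b) : wc_comp (wclass (wnil b)) P = P.
Proof. by have [p ->] := wclassP P; rewrite wc_compE wcat0. Qed.

Lemma wc_compc1 a b (P : word_class a b) : wc_comp P (wclass (wnil a)) = P.
Proof. by have [p ->] := wclassP P; rewrite wc_compE. Qed.

Definition localization : category :=
  @Category M word_class (fun a => wclass (wnil a)) wc_comp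
    wc_compA wc_comp1c wc_compc1.

Lemma loc_functor_subproof1 a :
  wclass (wfwd1 (idc a)) = @idc localization a.
Proof. by apply: wclass_eq; apply: weq_id. Qed.

Lemma loc_functor_subproofM a b c (g : Hom b c) (f : Hom a b) :
  wclass (wfwd1 (g \oc f)) =
  @comp localization _ _ _ (wclass (wfwd1 g)) (wclass (wfwd1 f)).
Proof.
by rewrite /= wc_compE; apply: wclass_eq; apply: weq_sym; apply: weq_comp.
Qed.

Definition loc_functor : functor M localization :=
  @Functor M localization id (fun a b f => wclass (wfwd1 f))
    loc_functor_subproof1 loc_functor_subproofM.
End Localization.

(* The elements of the union of the U_n form the type [uset]; [is_universe] is
   the SGA 4 notion.  Since [univ 0] is nonempty and belongs to [univ 1], the
   latter contains an infinite set. *)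
Section Universe.
Variables (T : Type) (uin : T -> T -> Prop).

Record is_universe (U : T) : Prop := IsUniverse {
  univ_nonempty : exists x, uin x U;
  univ_trans : forall x y, uin x U -> uin y x -> uin y U;
  univ_pair : forall x y, uin x U -> uin y U ->
    exists2 z, uin z U & forall t, uin t z <-> t = x \/ t = y;
  univ_powerset : forall x, uin x U ->
    exists2 z, uin z U & forall t, uin t z <-> (forall s, uin s t -> uin s x);
  univ_union : forall (I : T) (x : T -> T), uin I U ->
    (forall i, uin i I -> uin (x i) U) ->
    exists2 z, uin z U &
      forall t, uin t z <-> exists2 i, uin i I & uin t (x i) }.
End Universe.

Record universe_hierarchy := UniverseHierarchy {
  uset :> Type;
  uin : uset -> uset -> Prop;
  univ : nat -> uset;
  uset_ext : forall x y, (forall t, uin t x <-> uin t y) -> x = y;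
  uset_wf : well_founded uin;
  uset_sep : forall (x : uset) (P : uset -> Prop),
    exists y, forall t, uin t y <-> uin t x /\ P t;
  univP : forall n, is_universe uin (univ n);
  univ_mem : forall n, uin (univ n) (univ n.+1);
  univ_cover : forall x, exists n, uin x (univ n) }.

Section Stage.
Variables (S T : Type) (mem : T -> T -> Prop) (atom : S -> T).

Definition non_atom (x : T) : Prop := forall s, x <> atom s.

(* V_0 = S and V_(n+1) = V_n \cup P(V_n) *)
Fixpoint in_stage (n : nat) (x : T) : Prop :=
  match n with
  | 0 => exists s, x = atom s
  | n'.+1 => in_stage n' x \/
             (non_atom x /\ forall y, mem y x -> in_stage n' y)
  end.
End Stage.

(* The superstructure over S, the union of the V_n, described up to unique
   isomorphism; individuals have no elements.  [subset_of n P] is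
   {x in V_n | P x} for an arbitrary P, so each V_(n+1) contains the full
   power set of V_n. *)
Record superstructure (S : Type) := Superstructure {
  sset :> Type;
  smem : sset -> sset -> Prop;
  atom : S -> sset;
  atom_inj : injective atom;
  smem_atom : forall s x, ~ smem x (atom s);
  sset_ext : forall x y, non_atom atom x -> non_atom atom y ->
    (forall t, smem t x <-> smem t y) -> x = y;
  sset_stage : forall x, exists n, in_stage smem atom n x;
  subset_of : nat -> (sset -> Prop) -> sset;
  subset_of_set : forall n P, non_atom atom (subset_of n P);
  subset_ofP : forall n P x,
    smem x (subset_of n P) <-> in_stage smem atom n x /\ P x }.

Section SetTheory.
Variables (S : Type) (V : superstructure S).

Definition is_set (x : V) : Prop := non_atom (@atom S V) x.

Definition individuals : V := subset_of 0 (fun _ : V => True).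

Definition is_upair (z x y : V) : Prop :=
  forall t, smem t z <-> t = x \/ t = y.

(* Kuratowski pairs *)
Definition is_pair (z x y : V) : Prop :=
  forall t, smem t z <-> is_upair t x x \/ is_upair t x y.

(* <x1, x2, ..., xn> = <x1, <x2, ..., xn>> *)
Fixpoint is_tuple (z x : V) (xs : seq V) : Prop :=
  match xs with
  | [::] => z = x
  | y :: ys => exists2 z', is_tuple z' y ys & is_pair z x z'
  end.

Definition related (r x y : V) : Prop := exists2 z, smem z r & is_pair z x y.
End SetTheory.

(* Formulas in the language of set theory with bounded quantifiers, with
   de Bruijn indices: [FAll j p] reads "for all x in x_j, p", where index 0 of p
   refers to x and index i.+1 to x_i.  Constants are free variables. *)
Inductive formula :=
| FMem of nat & nat
| FEq of nat & nat
| FNot of formula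
| FAnd of formula & formula
| FOr of formula & formula
| FImp of formula & formula
| FAll of nat & formula
| FEx of nat & formula.

Definition env_cons (T : Type) (x : T) (e : nat -> T) (i : nat) : T :=
  if i is i'.+1 then e i' else x.

Fixpoint holds (S : Type) (V : superstructure S) (e : nat -> V) (p : formula) :
  Prop :=
  match p with
  | FMem i j => smem (e i) (e j)
  | FEq i j => e i = e j
  | FNot q => ~ holds e q
  | FAnd q r => holds e q /\ holds e r
  | FOr q r => holds e q \/ holds e r
  | FImp q r => holds e q -> holds e r
  | FAll j q => forall x, smem x (e j) -> holds (env_cons x e) q
  | FEx j q => exists2 x, smem x (e j) & holds (env_cons x e) q
  end.

(* S' plays the role of *S. *)
Record is_enlargement (S S' : Type) (V : superstructure S)
    (V' : superstructure S') (star : V -> V') : Prop := IsEnlargement {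
  star_individuals : star (individuals V) = individuals V';
  star_transfer : forall (p : formula) (e : nat -> V),
    holds e p <-> holds (fun i => star (e i)) p;
  star_concurrence : forall r : V,
    (forall l : list V,
      (forall a, List.In a l -> exists b, related r a b) ->
      exists b, forall a, List.In a l -> related r a b) ->
    exists b' : V', forall a,
      (exists b, related r a b) -> related (star r) (star a) b' }.

Definition internal (S S' : Type) (V : superstructure S)
    (V' : superstructure S') (star : V -> V') (x : V') : Prop :=
  exists A : V, smem x (star A).

Section UniversesInS.
Variables (U : universe_hierarchy) (S : Type) (V : superstructure S).
Variable inj : U -> S.

Definition univ_set (n : nat) : V :=
  subset_of 0 (fun x : V => exists2 t : U, uin t (univ U n) & x = atom V (inj t)).

(* The membership relation between elements of the universes, as a set of
   pairs of individuals. *)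
Definition univ_mem_rel : V :=
  subset_of 2 (fun z : V => exists t u : U,
    uin t u /\ is_pair z (atom V (inj t)) (atom V (inj u))).
End UniversesInS.

(* [u] is a universe in the sense of the (possibly enlarged) membership [eps],
   both elements of V: they are U_1 and its membership relation, or their images
   under the enlargement.  A u-small category is a tuple
   <o, a, s, t, i, k> of its sets o, a in u of objects and of morphisms (sets in
   the sense of eps) and of the graphs of source, target, identity and
   composition. *)
Section Coding.
Variables (S : Type) (V : superstructure S) (u eps : V).

Record category_code := CategoryCode {
  c_obj : V; c_mor : V; c_src : V; c_tgt : V; c_id : V; c_comp : V }.

Definition category_tuple (z : V) (c : category_code) : Prop :=
  is_tuple z (c_obj c) [:: c_mor c; c_src c; c_tgt c; c_id c; c_comp c].

(* [reads c C]: the category C is the u-small category coded by c, under the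
   naming [rob], [rmor] of its objects and morphisms by elements of V. *)
Record reads (c : category_code) (C : category) := Reads {
  rob : C -> V;
  rmor : forall a b : C, Hom a b -> V;
  rob_inj : injective rob;
  rmor_ends : forall (a b a' b' : C) (f : Hom a b) (f' : Hom a' b'),
    rmor f = rmor f' -> a = a' /\ b = b';
  rmor_inj : forall a b : C, injective (@rmor a b);
  reads_small : smem (c_obj c) u /\ smem (c_mor c) u;
  reads_sets : [/\ is_set (c_src c), is_set (c_tgt c), is_set (c_id c)
                 & is_set (c_comp c)];
  reads_obj : forall x, related eps x (c_obj c) <-> exists a, x = rob a;
  reads_mor : forall x, related eps x (c_mor c) <->
    exists (a b : C) (f : Hom a b), x = rmor f;
  reads_src : forall z, smem z (c_src c) <->
    exists (a b : C) (f : Hom a b), is_pair z (rmor f) (rob a);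
  reads_tgt : forall z, smem z (c_tgt c) <->
    exists (a b : C) (f : Hom a b), is_pair z (rmor f) (rob b);
  reads_id : forall z, smem z (c_id c) <->
    exists a : C, is_pair z (rob a) (rmor (idc a));
  reads_comp : forall z, smem z (c_comp c) <->
    exists (a b d : C) (g : Hom b d) (f : Hom a b),
      is_tuple z (rmor g) [:: rmor f; rmor (g \oc f)] }.

Definition reads_class (c : category_code) (C : category) (r : reads c C)
    (w : V) (K : mor_class C) : Prop :=
  is_set w /\
  forall x, smem x w <-> exists (a b : C) (f : Hom a b), K a b f /\ x = rmor r f.

(* A functor is coded by the pair of graphs of its object and morphism parts. *)
Definition reads_functor (c d : category_code) (C D : category)
    (r : reads c C) (r' : reads d D) (g : V) (G : functor C D) : Prop :=
  exists g0 g1 : V, [/\ is_pair g g0 g1,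
    is_set g0 /\
      forall z, smem z g0 <-> exists a : C, is_pair z (rob r a) (rob r' (G a)) &
    is_set g1 /\
      forall z, smem z g1 <-> exists (a b : C) (f : Hom a b),
        is_pair z (rmor r f) (rmor r' (fmap G f))].

Record model_code := ModelCode {
  m_cat : category_code; m_W : V; m_F : V; m_C : V }.

Definition model_tuple (z : V) (m : model_code) : Prop :=
  exists2 zc, category_tuple zc (m_cat m) & is_tuple z zc [:: m_W m; m_F m; m_C m].

Record model_reads (m : model_code) (M : category) (W F C : mor_class M) :=
  ModelReads {
  mr_cat :> reads (m_cat m) M;
  mr_W : reads_class mr_cat (m_W m) W;
  mr_F : reads_class mr_cat (m_F m) F;
  mr_C : reads_class mr_cat (m_C m) C }.

(* [homotopy_value zm v]: zm codes a u-small model category and v is a pair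
   <L, gamma> of a u-small category L and a functor gamma to L which is
   isomorphic, under zm, to the localization of zm by its weak equivalences. *)
Definition homotopy_value (zm v : V) : Prop :=
  exists (m : model_code) (M : category) (W F C : mor_class M)
    (rM : model_reads m W F C),
  [/\ model_tuple zm m, is_model_category W F C &
  exists (zl g : V) (cl : category_code) (L : category) (rL : reads cl L)
    (gamma : functor M L) (Phi : functor (localization W) L),
  [/\ category_tuple zl cl, is_pair v zl g, reads_functor rM rL g gamma,
      functor_iso Phi & functor_comp Phi (loc_functor W) = gamma]].

Definition small_model_category (zm : V) : Prop :=
  exists (m : model_code) (M : category) (W F C : mor_class M)
    (rM : model_reads m W F C),
  model_tuple zm m /\ is_model_category W F C.

(* [Ho] is a function, as a set of pairs, that assigns to each u-small model
   category its homotopy category together with the canonical functor. *)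
Definition is_homotopy_function (Ho : V) : Prop :=
  [/\ is_set Ho,
      forall z, smem z Ho -> exists zm v, is_pair z zm v /\ homotopy_value zm v &
      forall zm, small_model_category zm -> exists! v, related Ho zm v].
End Coding.

(* <M, W, F, C>, named by [rM], is an internal model category: its sets of
   objects and of morphisms lie in *U_1 (part of [rM]), its structure maps and
   W, F, C are internal. *)
Definition is_internal_model_category (S S' : Type) (V : superstructure S)
    (V' : superstructure S') (star : V -> V') (u eps : V) (m : model_code V')
    (M : category) (W F C : mor_class M)
    (rM : model_reads (star u) (star eps) m W F C) : Prop :=
  [/\ is_model_category W F C,
      [/\ internal star (c_src (m_cat m)), internal star (c_tgt (m_cat m)),
          internal star (c_id (m_cat m)) & internal star (c_comp (m_cat m))] &
      [/\ internal star (m_W m), internal star (m_F m) & internal star (m_C m)]].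

(* Main.v *)
(* The two localizations can only differ because words in *Ho(M) may have
   *finite length. In a model category the localization functor gamma : M ->
   Ho(M) is pinned down, up to an isomorphism under M, by statements that
   involve bounded data only: gamma is bijective on objects and inverts W;
   every m : gamma a -> gamma b satisfies gamma s . m . gamma t = gamma f for
   some s, t in W and some f in M; and two maps from a cofibrant to a fibrant
   object with the same image under gamma are left homotopic ([loc_like]).
   These statements, the axioms of a model category (finite limits reduce to
   a terminal object, binary products and equalizers) and the coding of
   categories by sets are expressed by bounded formulas. Hence the fact that
   every small model category has a value under Ho satisfying [loc_like]
   transfers, and the same characterization, read externally in M, identifies
   the value of *Ho with the external localization. *)

From mathcomp Require Import all_boot.
From mathcomp Require Import boolp.
From Stdlib Require List.
Require Import Defs.

Set Implicit Arguments.
Unset Strict Implicit.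
Unset Printing Implicit Defensive.

(** * Categories and their localizations *)

(** The values of [Ho] are described by an isomorphism with [localization W], an inductive type of
    words that lies outside the formulas. Hence [loc_like] is used in two directions: in V it is
    deduced from this isomorphism, in M it produces one. The delicate clause is the one on
    homotopies. An equality of words may pass through arbitrarily long intermediate words, so it is
    not analysed directly. Instead a functor on M is built that inverts W and still separates
    homotopy classes of maps from a cofibrant to a fibrant object; by the universal property it
    factors through the localization, which therefore separates them too. The clause on fractions is
    an induction on the word, in which a formal inverse is absorbed by one factorization and two
    liftings. Transfer concerns elements of superstructures, homotopy theory concerns [category]
    records. Codes are therefore both decoded into categories and obtained from them, and every set
    quantifier is bounded by a stage V_n that contains [Ho]. *)

Definition op (C : category) : category :=
  @Category C (fun a b => @Hom C b a) (@idc C) (fun a b c g f => f \oc g)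
    (fun a b c d h g f => esym (compA f g h))
    (fun a b f => compc1 f) (fun a b f => comp1c f).

Definition op_class (C : category) (K : mor_class C) : mor_class (op C) :=
  fun a b f => K b a f.

Definition op_functor (C D : category) (F : functor C D) :
  functor (op C) (op D) :=
  @Functor (op C) (op D) F (fun a b f => @fmap _ _ F b a f) (fmap1 F)
    (fun a b c g f => @fmapM _ _ F _ _ _ f g).

Section Inverses.
Variable C : category.

Definition inverse (a b : C) (f : Hom a b) (g : Hom b a) : Prop :=
  g \oc f = idc a /\ f \oc g = idc b.

Lemma inverse_epi (a b c : C) (f : Hom a b) f' (g h : Hom b c) :
  inverse f f' -> g \oc f = h \oc f -> g = h.
Proof.
by case=> _ ff' e; rewrite -[g]compc1 -[h]compc1 -ff' !compA e.
Qed.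

Lemma inverse_mono (a b c : C) (f : Hom b c) f' (g h : Hom a b) :
  inverse f f' -> f \oc g = f \oc h -> g = h.
Proof.
by case=> f'f _ e; rewrite -[g]comp1c -[h]comp1c -f'f -!compA e.
Qed.
End Inverses.

Lemma inverse_fmap (C D : category) (F : functor C D) (a b : C) (f : Hom a b)
    (g : Hom b a) :
  inverse f g -> inverse (fmap F f) (fmap F g).
Proof. by case=> gf fg; split; rewrite -fmapM ?gf ?fg fmap1. Qed.

(** Proof irrelevance makes every equality of [a] with itself reflexive, so no decidable equality on
    [A] is involved. *)
Lemma existT_inj (A : Type) (P : A -> Type) (a : A) (x y : P a) :
  existT P a x = existT P a y -> x = y.
Proof.
move=> e; have /= := projT2_eq e.
by rewrite (Prop_irrelevance (projT1_eq e) erefl).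
Qed.

(* Morphisms of different hom-types are compared through the total type of
   arrows, which avoids transport along equalities of objects. *)
Definition arr (C : category) (a b : C) (f : Hom a b) :
  {a : C & {b : C & Hom a b}} :=
  existT _ a (existT (fun b => Hom a b) b f).

Section Arrows.
Variable C : category.

Lemma arr_inj (a b : C) : injective (@arr C a b).
Proof. by move=> f g e; apply: existT_inj (existT_inj e). Qed.

Lemma arr_ends (a b a' b' : C) (f : Hom a b) (f' : Hom a' b') :
  arr f = arr f' -> a = a' /\ b = b'.
Proof. by case. Qed.

Lemma arr_idc (a b : C) : a = b -> arr (idc a) = arr (idc b).
Proof. by move=> ->. Qed.

Lemma arr_comp (a b c a' b' c' : C) (g : Hom b c) (f : Hom a b)
    (g' : Hom b' c') (f' : Hom a' b') :
  arr g = arr g' -> arr f = arr f' -> arr (g \oc f) = arr (g' \oc f').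
Proof.
move=> eg ef; have [eb ec] := arr_ends eg; have [ea _] := arr_ends ef.
move: eg ef; case: b' / eb g' f' => g' f'.
case: c' / ec g' => g'; case: a' / ea f' => f'.
by move=> /arr_inj -> /arr_inj ->.
Qed.

Lemma arr_cast (a b a' b' : C) (f : Hom a b) :
  a = a' -> b = b' -> exists f' : Hom a' b', arr f' = arr f.
Proof. by move=> <- <-; exists f. Qed.
End Arrows.

Lemma arr_fmap (C D : category) (F : functor C D) (a b a' b' : C) (f : Hom a b)
    (f' : Hom a' b') :
  arr f = arr f' -> arr (fmap F f) = arr (fmap F f').
Proof.
move=> e; have [ea eb] := arr_ends e; move: e.
case: a' / ea f' => f'; case: b' / eb f' => f'.
by move=> /arr_inj ->.
Qed.

(** Equal total arrows have equal endpoints, so the object parts are recovered from the identities;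
    after that the morphism parts have the same type. *)
Lemma functor_ext (C D : category) (F G : functor C D) :
  (forall (a b : C) (f : Hom a b), arr (fmap F f) = arr (fmap G f)) -> F = G.
Proof.
case: F G => [F0 F1 Fid FM] [G0 G1 Gid GM] /= e.
have e0 : F0 = G0 by apply: funext => a; case: (arr_ends (e _ _ (idc a))).
case: G0 / e0 G1 Gid GM e => G1 Gid GM e.
have e1 : F1 = G1.
  apply: functional_extensionality_dep => a.
  apply: functional_extensionality_dep => b.
  by apply: funext => f; apply: arr_inj.
case: G1 / e1 Gid GM e => Gid GM _.
by rewrite (Prop_irrelevance Gid Fid) (Prop_irrelevance GM FM).
Qed.

Section FunctorIso.
Variables (C D : category) (F : functor C D).

Definition ob_bijective : Prop :=
  injective F /\ forall y : D, exists x : C, F x = y.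

Definition faithful : Prop := forall a b : C, injective (@fmap _ _ F a b).

Definition full : Prop :=
  forall (a b : C) (m : Hom (F a) (F b)), exists f, fmap F f = m.

Lemma functor_iso_ob_bijective : functor_iso F -> ob_bijective.
Proof.
case=> G [GF FG]; split=> [a b e|y].
- have fobE x : G (F x) = x by rewrite -[LHS]/(functor_comp G F x) GF.
  by rewrite -[a]fobE e fobE.
- by exists (G y); rewrite -[LHS]/(functor_comp F G y) FG.
Qed.

Lemma functor_iso_faithful : functor_iso F -> faithful.
Proof.
case=> G [GF _] a b f g e; apply: arr_inj.
have fmapE h : arr (fmap G (fmap F h)) = @arr C a b h.
  by rewrite -[LHS]/(arr (fmap (functor_comp G F) h)) GF.
by rewrite -fmapE e fmapE.
Qed.

Lemma functor_iso_full : functor_iso F -> full.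
Proof.
case=> G [GF FG] a b m.
have fobE x : G (F x) = x by rewrite -[LHS]/(functor_comp G F x) GF.
have [f ef] := arr_cast (fmap G m) (fobE a) (fobE b).
exists f; apply: arr_inj; rewrite (arr_fmap F ef).
by rewrite -[LHS]/(arr (fmap (functor_comp F G) m)) FG.
Qed.

(** Objects correspond on the nose, so the inverse is strict: it sends a morphism to the unique
    preimage of its transport along [F (g y) = y]. *)
Lemma full_faithful_functor_iso :
  ob_bijective -> full -> faithful -> functor_iso F.
Proof.
case=> F_inj /choice[g gK] fullF faithF.
have lift (y y' : D) (m : Hom y y') :
    {f : Hom (g y) (g y') | arr (fmap F f) = arr m}.
  apply: cid; have [m' <-] := arr_cast m (esym (gK y)) (esym (gK y')).
  by have [f <-] := fullF _ _ m'; exists f.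
have liftE y y' (m : Hom y y') f : arr (fmap F f) = arr m ->
  sval (lift _ _ m) = f.
  by case: lift => f' /= <- /arr_inj/faithF.
have G1 y : sval (lift _ _ (idc y)) = idc (g y).
  by apply: liftE; rewrite fmap1; apply: arr_idc.
have GM x y z (n : Hom y z) (m : Hom x y) :
    sval (lift _ _ (n \oc m)) = sval (lift _ _ n) \oc sval (lift _ _ m).
  by apply: liftE; rewrite fmapM; apply: arr_comp; apply: (svalP (lift _ _ _)).
exists (@Functor D C g (fun y y' m => sval (lift y y' m)) G1 GM).
split; apply: functor_ext => a b f /=; last exact: (svalP (lift _ _ _)).
have gFK x : g (F x) = x by apply: F_inj; rewrite gK.
have [f' ef] := arr_cast f (esym (gFK a)) (esym (gFK b)).
by rewrite -ef; congr arr; apply: liftE; apply: arr_fmap.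
Qed.
End FunctorIso.

Section LocalizationUniversal.
Variables (M L : category) (W : mor_class M) (G : functor M L).

Definition inverts : Prop :=
  forall (a b : M) (s : Hom a b), W s -> exists s', inverse (fmap G s) s'.

(** Words are evaluated in [L], with a chosen inverse for each formal one. A morphism of the
    localization is a class of words, evaluated at a chosen representative; [ev_eq] makes the choice
    harmless. *)
Lemma localization_extension :
  inverts -> exists Phi : functor (localization W) L,
    [/\ functor_comp Phi (loc_functor W) = G & forall a, Phi a = G a].
Proof.
move=> GW; pose inv a b (s : Hom a b) (Ws : W s) := sval (cid (GW a b s Ws)).
have invP a b (s : Hom a b) (Ws : W s) : inverse (fmap G s) (inv a b s Ws).
  by rewrite /inv; case: cid.
pose ev := fix ev a b (p : word W a b) : Hom (G a) (G b) :=
  match p with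
  | wnil a => idc (G a)
  | wfwd _ _ _ f p' => ev _ _ p' \oc fmap G f
  | wbwd _ _ _ s Ws p' => ev _ _ p' \oc inv _ _ s Ws
  end.
have ev_cat a b c (p : word W a b) (q : word W b c) :
    ev _ _ (wcat p q) = ev _ _ q \oc ev _ _ p.
  elim: p q => [x|x y z f p IH|x y z s Ws p IH] q /=; first by rewrite compc1.
  - by rewrite IH compA.
  - by rewrite IH compA.
have ev_eq a b (p q : word W a b) : word_eq p q -> ev _ _ p = ev _ _ q.
  elim=> {a b p q} //=.
  - by move=> a b p q r _ -> _ ->.
  - by move=> a b c p p' q q' _ ep _ eq; rewrite !ev_cat ep eq.
  - by move=> a; rewrite fmap1 comp1c.
  - by move=> a b c g f; rewrite !comp1c fmapM.
  - by move=> a b s Ws; rewrite comp1c (invP _ _ s Ws).1.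
  - by move=> a b s Ws; rewrite comp1c (invP _ _ s Ws).2.
pose evc a b (P : word_class W a b) := ev _ _ (sval (cid (wclassP P))).
have evcE a b (p : word W a b) : evc _ _ (wclass p) = ev _ _ p.
  rewrite /evc; case: cid => q /= e; apply/esym/ev_eq.
  (* Membership of [q] in the class of [p] unfolds to [word_eq p q]. *)
  have : wc (wclass p) q by rewrite e; apply: weq_refl.
  by [].
have Phi1 (a : localization W) : evc _ _ (idc a) = idc (G a) by rewrite evcE.
have PhiM (a b c : localization W) (Q : Hom b c) (P : Hom a b) :
    evc _ _ (Q \oc P) = evc _ _ Q \oc evc _ _ P.
  have [p ->] := wclassP P; have [q ->] := wclassP Q.
  by rewrite /= wc_compE !evcE ev_cat.
exists (@Functor (localization W) L G evc Phi1 PhiM); split=> //.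
by apply: functor_ext => a b f /=; rewrite evcE /= comp1c.
Qed.

Lemma loc_functor_inverse (a b : M) (s : Hom a b) (Ws : W s) :
  inverse (fmap (loc_functor W) s) (wclass (wbwd1 Ws)).
Proof.
by split; rewrite /= wc_compE; apply: wclass_eq; [apply: weq_fb|apply: weq_bf].
Qed.
End LocalizationUniversal.

(** * Finite limits *)

Section BasicLimits.
Variable C : category.

(** This and the next two definitions are written in the shape of the formulas that later express
    them; for terminal objects and products the two versions then agree by computation. *)
Definition has_terminal : Prop :=
  exists t : C, forall x : C, exists f : Hom x t, forall g : Hom x t, g = f.

Definition has_products : Prop :=
  forall a b : C, exists (p : C) (p0 : Hom p a) (p1 : Hom p b),
  forall (x : C) (f0 : Hom x a) (f1 : Hom x b), exists h : Hom x p,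
    (f0 = p0 \oc h /\ f1 = p1 \oc h) /\
    forall k : Hom x p, f0 = p0 \oc k -> f1 = p1 \oc k -> k = h.

Definition has_equalizers : Prop :=
  forall (a b : C) (f g : Hom a b), exists (e : C) (i : Hom e a),
  f \oc i = g \oc i /\
  forall (x : C) (j : Hom x a), f \oc j = g \oc j -> exists h : Hom x e,
    j = i \oc h /\ forall k : Hom x e, j = i \oc k -> k = h.

Definition has_basic_limits : Prop :=
  has_terminal /\ has_products /\ has_equalizers.
End BasicLimits.

Section DiscreteCategory.
Variable T : Type.

Definition discrete : category :=
  @Category T (fun a b => a = b) (fun a => erefl)
    (fun a b c g f => etrans f g) (fun a b c d h g f => Prop_irrelevance _ _)
    (fun a b f => Prop_irrelevance _ _) (fun a b f => Prop_irrelevance _ _).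

Lemma finite_discrete : finite_type T -> finite_category discrete.
Proof.
move=> T_fin; split=> // a b; have [e|ne] := pselect (a = b).
- by exists [:: e] => e'; left; apply: (@Prop_irrelevance (a = b)).
- by exists [::] => e; case: (ne e).
Qed.

Variables (C : category) (D : T -> C).

Definition discrete_fmap (a b : discrete) (e : Hom a b) : Hom (D a) (D b) :=
  match e in _ = b return Hom (D a) (D b) with erefl => idc (D a) end.

Lemma discrete_fmapM (a b c : discrete) (g : Hom b c) (f : Hom a b) :
  discrete_fmap (g \oc f) = discrete_fmap g \oc discrete_fmap f.
Proof. by case: c / g; case: b / f; rewrite /= comp1c. Qed.

Definition discrete_functor : functor discrete C :=
  @Functor discrete C D discrete_fmap (fun=> erefl) discrete_fmapM.
End DiscreteCategory.

Section ParallelPair.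

(** The shape of an equalizer diagram: two arrows from [false] to [true], themselves named by the
    booleans, besides the identities. *)
Definition pair_hom (a b : bool) : Type :=
  match a, b with
  | false, true => bool
  | true, false => Empty_set
  | _, _ => unit
  end.

Definition pair_id (a : bool) : pair_hom a a :=
  if a return pair_hom a a then tt else tt.

Definition pair_comp (a b c : bool) :
  pair_hom b c -> pair_hom a b -> pair_hom a c :=
  match a, b, c with
  | false, false, true => fun g _ => g
  | false, true, true => fun _ f => f
  | true, false, _ => fun _ f => match f with end
  | _, true, false => fun g _ => match g with end
  | _, _, _ => fun _ _ => tt
  end.

Lemma pair_compA (a b c d : bool) (h : pair_hom c d) (g : pair_hom b c)
    (f : pair_hom a b) :
  pair_comp h (pair_comp g f) = pair_comp (pair_comp h g) f.
Proof. by move: a b c d h g f => [] [] [] [] // [] // [] // []. Qed.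

Lemma pair_comp1c (a b : bool) (f : pair_hom a b) : pair_comp (pair_id b) f = f.
Proof. by move: a b f => [] [] // []. Qed.

Lemma pair_compc1 (a b : bool) (f : pair_hom a b) : pair_comp f (pair_id a) = f.
Proof. by move: a b f => [] [] // []. Qed.

Definition parallel_pair : category :=
  @Category bool pair_hom pair_id pair_comp pair_compA pair_comp1c pair_compc1.

Lemma finite_parallel_pair : finite_category parallel_pair.
Proof.
split; first by exists [:: true; false] => -[]; [left|right; left].
case=> -[]; [|by exists [::] => -[]| |]; try by exists [:: tt] => -[]; left.
by exists [:: true; false] => -[]; [left|right; left].
Qed.

Variables (C : category) (a b : C) (f g : Hom a b).

Definition pair_fob (x : parallel_pair) : C := if x then b else a.

Definition pair_fmap (x y : parallel_pair) :
  Hom x y -> Hom (pair_fob x) (pair_fob y) :=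
  match x, y return pair_hom x y -> Hom (pair_fob x) (pair_fob y) with
  | false, true => fun u : bool => if u then f else g
  | true, false => fun u => match u with end
  | true, true => fun=> idc b
  | false, false => fun=> idc a
  end.

Lemma pair_fmap1 (x : parallel_pair) : pair_fmap (idc x) = idc (pair_fob x).
Proof. by case: x. Qed.

Lemma pair_fmapM (x y z : parallel_pair) (v : Hom y z) (u : Hom x y) :
  pair_fmap (v \oc u) = pair_fmap v \oc pair_fmap u.
Proof.
by move: x y z v u => [] [] [] [] // [] //=; rewrite ?comp1c ?compc1.
Qed.

Definition pair_functor : functor parallel_pair C :=
  @Functor parallel_pair C pair_fob pair_fmap pair_fmap1 pair_fmapM.
End ParallelPair.

Section FiniteToBasic.
Variable C : category.
Hypothesis lim : has_finite_limits C.

Lemma finite_limits_terminal : has_terminal C.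
Proof.
have fin : finite_type Empty_set by exists [::] => -[].
pose D := discrete_functor (fun x : Empty_set => match x with end : C).
have [t [p [_ tP]]] := lim D (finite_discrete fin).
exists t => x; have [|h [_ hP]] := tP x (fun j => match j with end);
  first by case.
by exists h => g; apply/esym/hP; case.
Qed.

Lemma finite_limits_products : has_products C.
Proof.
move=> a b.
have fin : finite_type bool by exists [:: true; false] => -[]; [left|right;
  left].
pose D := discrete_functor (fun x : bool => if x then b else a).
have [l [p [_ lP]]] := lim D (finite_discrete fin).
exists l, (p false), (p true) => x f0 f1.
have [|h [hE hP]] := lP x (fun j : bool =>
  if j return Hom x (D j) then f1 else f0).
  by move=> i j; case: j /; apply: comp1c.
exists h; split; first by rewrite (hE true) (hE false).
by move=> k e0 e1; apply/esym/hP => -[].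
Qed.

Lemma finite_limits_equalizers : has_equalizers C.
Proof.
move=> a b f g.
have [l [p [pC lP]]] := lim (pair_functor f g) finite_parallel_pair.
exists l, (p false); split.
  have := pC false true true; have := pC false true false.
  by move=> /= -> ->.
move=> x j fg.
have [|h [hE hP]] := lP x (fun i : bool =>
    if i return Hom x (pair_functor f g i) then f \oc j else j).
  by case=> [] [] //= []; rewrite ?comp1c.
exists h; split; first by rewrite (hE false).
move=> k e; apply/esym/hP => -[] //=.
by rewrite e compA; congr (_ \oc k); apply/esym; apply: (pC false true true).
Qed.
End FiniteToBasic.

Section BasicToFinite.
Variables (J C : category) (D : functor J C).
Hypothesis lim : has_basic_limits C.

Lemma list_product (s : list J) : exists (l : C)
    (p : forall j, List.In j s -> Hom l (D j)),
  forall (x : C) (q : forall j, List.In j s -> Hom x (D j)),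
    exists! h : Hom x l, forall j sj, p j sj \oc h = q j sj.
Proof.
have [[t tP] [prod _]] := lim.
elim: s => [|a s [l [p lP]]].
  exists t, (fun j (sj : False) => match sj with end) => x q;
    have [f fP] := tP x.
  by exists f; split=> [j []|g _]; apply/esym/fP.
(* Legs are indexed by objects, not by positions in the list, so an object that occurs again
   contributes no new factor. *)
have [as_|nas] := pselect (List.In a s).
  have sub j : List.In j (a :: s) -> List.In j s by case=> [<-|].
  exists l, (fun j sj => p j (sub j sj)) => x q.
  have [h [hE hP]] := lP x (fun j sj => q j (or_intror sj)).
  exists h; split=> [j sj|k kE]; first by rewrite hE; congr (q j _).
  by apply: hP => j sj; rewrite -kE; congr (p j _ \oc _).
have [m [m0 [m1 mP]]] := prod (D a) l.
have tl j : List.In j (a :: s) -> a <> j -> List.In j s by case.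
pose p' j (sj : List.In j (a :: s)) : Hom m (D j) :=
  match pselect (a = j) with
  | left e => match e in _ = j return Hom m (D j) with erefl => m0 end
  | right ne => p j (tl j sj ne) \oc m1
  end.
have p'a sj : p' a sj = m0.
  rewrite /p'; case: pselect => // e.
  by rewrite (Prop_irrelevance e erefl).
have p's j sj sj' : p' j sj = p j sj' \oc m1.
  rewrite /p'; case: pselect => [e|ne]; last by congr (p j _ \oc _).
  by case: nas; rewrite e.
exists m, p' => x q.
have [h1 [h1E h1P]] := lP x (fun j sj => q j (or_intror sj)).
have [h [[h0E h1E'] hP]] := mP x (q a (or_introl erefl)) h1.
exists h; split=> [j sj|k kE].
  case: (sj) => [e|sj'].
    case: j / e sj => sj; rewrite p'a -h0E; congr (q a _).
  by rewrite (p's _ _ sj') -compA -h1E' h1E; congr (q j _).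
apply/esym/hP; first by rewrite -(kE a (or_introl erefl)) p'a.
apply: h1P => j sj.
by rewrite -(kE j (or_intror sj)) (p's _ _ sj) compA.
Qed.

Definition respects (s : list {i : J & {j : J & Hom i j}}) (x : C)
    (q : forall j, Hom x (D j)) : Prop :=
  forall i j (u : Hom i j), List.In (arr u) s -> fmap D u \oc q i = q j.

(** Start from the product over all objects and impose the arrows one at a time: a further [u] is
    enforced by the equalizer of [fmap D u \oc p i] and [p j]. *)
Lemma list_limit (s : list {i : J & {j : J & Hom i j}}) :
  finite_type J -> exists (l : C) (p : forall j, Hom l (D j)),
  respects s p /\
  forall (x : C) (q : forall j, Hom x (D j)), respects s q ->
    exists! h : Hom x l, forall j, p j \oc h = q j.
Proof.
case=> obs obsP; elim: s => [|[i [j u]] s [l [p [pR lP]]]].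
  have [l [p lP]] := list_product obs.
  exists l, (fun j => p j (obsP j)); split=> // x q _.
  have [h [hE hP]] := lP x (fun j _ => q j).
  exists h; split=> [j|k kE]; first exact: hE.
  by apply: hP => j sj; rewrite -kE; congr (p j _ \oc _).
have [_ [_ eqz]] := lim.
have [e [m [em eP]]] := eqz _ _ (fmap D u \oc p i) (p j).
exists e, (fun j => p j \oc m); split.
  move=> i' j' u' [eu|su]; last by rewrite compA pR.
  have [ei ej] := arr_ends (eu : arr u = arr u').
  move: eu; case: i' / ei u' => u'; case: j' / ej u' => u' eu.
  by rewrite -(arr_inj eu) compA.
move=> x q qR; have [|h [hE hP]] := lP x q.
  by move=> i' j' u' su'; apply: qR; right.
have [|k [hk kP]] := eP x h.
  by rewrite -compA !hE; apply: qR; left.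
exists k; split=> [j'|k' k'E]; first by rewrite -compA -hk hE.
by apply/esym/kP; apply: hP => j'; rewrite compA.
Qed.
End BasicToFinite.

Lemma finite_arrows (J : category) : finite_category J ->
  finite_type {i : J & {j : J & Hom i j}}.
Proof.
case=> -[obs obsP] /(_ _ _)/cid-homs.
pose hs i j := sval (homs i j).
exists (List.flat_map (fun i => List.flat_map (fun j =>
  List.map (fun u : Hom i j => arr u) (hs i j)) obs) obs).
case=> i [j u]; apply/List.in_flat_map; exists i; split; first exact: obsP.
apply/List.in_flat_map; exists j; split; first exact: obsP.
by apply: List.in_map; apply: (svalP (homs i j)).
Qed.

Lemma has_finite_limitsE (C : category) :
  has_finite_limits C <-> has_basic_limits C.
Proof.
split=> [lim|lim J D fin].
  split; first exact: finite_limits_terminal.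
  by split; [apply: finite_limits_products|apply: finite_limits_equalizers].
have [s sP] := finite_arrows fin.
have [l [p [pR lP]]] := list_limit D lim s fin.1.
exists l, p; split=> [i j u|x q qC]; first exact: pR.
by apply: lP => i j u _; apply: qC.
Qed.

Definition unop_functor (C D : category) (F : functor C (op D)) :
  functor (op C) D :=
  @Functor (op C) D F (fun a b f => @fmap _ _ F b a f) (fmap1 F)
    (fun a b c g f => @fmapM _ _ F _ _ _ f g).

Lemma has_finite_colimitsE (C : category) :
  has_finite_colimits C <-> has_basic_limits (op C).
Proof.
split=> [colim|lim J D fin].
  apply/has_finite_limitsE => J D fin.
  have fin' : finite_category (op J) by split=> [|a b];
    [exact: fin.1|exact: fin.2].
  have [l [p [pC lP]]] := colim (op J) (unop_functor D) fin'.
  exists l, p; split=> [i j u|x q qC]; first exact: (pC j i u).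
  by apply: lP => i j u; apply: qC.
have fin' : finite_category (op J) by split=> [|a b];
  [exact: fin.1|exact: fin.2].
move/has_finite_limitsE: lim => /(_ (op J) (op_functor D) fin')[l [p [pC lP]]].
exists l, p; split=> [i j u|x q qC]; first exact: (pC j i u).
by apply: lP => i j u; apply: qC.
Qed.

(** * Homotopy in a model category *)

(** Duality exchanges [F] and [C]; fibrant objects and path objects are obtained from cofibrant
    objects and cylinders in this way. *)
Lemma is_model_category_op (M : category) (W F C : mor_class M) :
  is_model_category W F C ->
  is_model_category (op_class W) (op_class C) (op_class F).
Proof.
case=> lim colim [Wid Fid Cid] [Wc Fc Cc] W23 [Wr Fr Cr] lift fact; split.
- by apply/has_finite_limitsE/has_finite_colimitsE.
- by apply/has_finite_colimitsE; move/has_finite_limitsE: lim.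
- by [].
- by split=> a b c g f Kg Kf; [apply: Wc|apply: Cc|apply: Fc].
- by move=> a b c f g Wfg; rewrite or_comm => /(W23 _ _ _ _ _ Wfg)[].
- by split=> a b c d f g i r j s ri sj gi fr;
    [apply: (Wr _ _ _ _ f g s j r i)|apply: (Cr _ _ _ _ f g s j r i)
    |apply: (Fr _ _ _ _ f g s j r i)] => //; apply: esym.
- move=> a b x y i p f g e Cp Fi; rewrite or_comm => Wip.
  by have [h [hp ih]] := lift _ _ _ _ p i g f (esym e) Fi Cp Wip; exists h.
- move=> a b f; have [[x [i [p [-> Fp Wp Ci]]]] [x' [i' [p' [e Fp' Ci' Wi']]]]]
  := fact b a f.
  by split; [exists x', p', i'|exists x, p, i].
Qed.

Section LiftingObjects.
Variables (M : category) (W F C : mor_class M).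

(** Cofibrant objects, described by lifting against trivial fibrations so that no initial object has
    to be named; [injective_ob] describes the fibrant ones. *)
Definition projective_ob (a : M) : Prop :=
  forall (x y : M) (p : Hom x y), F p -> W p ->
  forall f : Hom a y, exists h : Hom a x, f = p \oc h.

Definition injective_ob (b : M) : Prop :=
  forall (x y : M) (i : Hom x y), C i -> W i ->
  forall f : Hom x b, exists h : Hom y b, f = h \oc i.

(** Only [s] is constrained, by being a weak equivalence. This already forces [f] and [g] to have
    the same image under every functor that inverts [W]. *)
Definition left_homotopic (a b : M) (f g : Hom a b) : Prop :=
  exists (c : M) (i0 i1 : Hom a c) (s : Hom c a) (H : Hom c b),
  [/\ W s, idc a = s \oc i0, idc a = s \oc i1, f = H \oc i0 & g = H \oc i1].

(* The last clause says that <i0, i1> : a + a -> c has the left lifting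
   property with respect to the trivial fibrations. *)
Record is_cylinder (a c : M) (i0 i1 : Hom a c) (s : Hom c a) : Prop :=
  IsCylinder {
    cyl_W : W s;
    cyl_s0 : s \oc i0 = idc a;
    cyl_s1 : s \oc i1 = idc a;
    cyl_0 : C i0 /\ W i0;
    cyl_1 : C i1 /\ W i1;
    cyl_lift : forall (x y : M) (p : Hom x y), F p -> W p ->
      forall (f0 f1 : Hom a x) (H : Hom c y),
      p \oc f0 = H \oc i0 -> p \oc f1 = H \oc i1 ->
      exists H' : Hom c x, [/\ H' \oc i0 = f0, H' \oc i1 = f1 & p \oc H' = H] }.
End LiftingObjects.

(** In the opposite category the ends of a cylinder become trivial fibrations [p0], [p1], and its
    lifting clause becomes extension along trivial cofibrations. *)
Definition is_path (M : category) (W F C : mor_class M) (b q : M)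
  (p0 p1 : Hom q b) (s : Hom b q) : Prop :=
  @is_cylinder (op M) (op_class W) (op_class C) (op_class F) b q p0 p1 s.

Section Cofibrant.
Variables (M : category) (W F C : mor_class M).
Hypothesis hM : is_model_category W F C.

(* The retract argument. *)
Lemma llp_cofibration (a b : M) (i : Hom a b) :
  (forall (x y : M) (p : Hom x y) (f : Hom a x) (g : Hom b y),
    F p -> W p -> p \oc f = g \oc i ->
    exists h : Hom b x, h \oc i = f /\ p \oc h = g) -> C i.
Proof.
move=> llp; have [[x [j [p [e Fp Wp Cj]]]] _] := mc_fact hM i.
have [|h [hi ph]] := llp _ _ p j (idc b) Fp Wp; first by rewrite comp1c.
have [_ _ rC] := mc_retract hM.
apply: (rC _ _ _ _ i j (idc a) (idc a) h p) => //; first exact: comp1c.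
- by rewrite compc1.
- by rewrite compc1.
Qed.

Definition is_coproduct (a b q : M) (i0 : Hom a q) (i1 : Hom b q) : Prop :=
  forall (x : M) (f0 : Hom a x) (f1 : Hom b x), exists h : Hom q x,
    (f0 = h \oc i0 /\ f1 = h \oc i1) /\
    forall k : Hom q x, f0 = k \oc i0 -> f1 = k \oc i1 -> k = h.

Lemma coproduct_sym (a b q : M) (i0 : Hom a q) (i1 : Hom b q) :
  is_coproduct i0 i1 -> is_coproduct i1 i0.
Proof.
move=> co x f0 f1; have [h [[h0 h1] hP]] := co x f1 f0.
by exists h; split=> // k k0 k1; apply: hP.
Qed.

Lemma coproduct_ext (a b q : M) (i0 : Hom a q) (i1 : Hom b q) x
    (h k : Hom q x) :
  is_coproduct i0 i1 -> h \oc i0 = k \oc i0 -> h \oc i1 = k \oc i1 -> h = k.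
Proof.
move=> co e0 e1; have [l [_ lP]] := co x (h \oc i0) (h \oc i1).
by rewrite (lP h) // -(lP k).
Qed.

(** The lifting property is checked directly: the given lift is used on the summand [a],
    projectivity provides one on [b]. *)
Lemma coproduct_cofibration (a b q : M) (i0 : Hom a q) (i1 : Hom b q) :
  is_coproduct i0 i1 -> projective_ob W F b -> C i0.
Proof.
move=> co pb; apply: llp_cofibration => x y p f g Fp Wp e.
have [f1 e1] := pb _ _ p Fp Wp (g \oc i1).
have [h [[h0 h1] _]] := co x f f1.
exists h; split=> //; apply: (coproduct_ext co).
- by rewrite -compA -h0.
- by rewrite -compA -h1.
Qed.

(** Factor the fold map [h] of the coproduct of [a] with itself as a cofibration [i] and a trivial
    fibration [s]. Two-out-of-three makes the ends weak equivalences, and the lifting clause is that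
    of [i]. *)
Lemma cylinder_exists (a : M) : projective_ob W F a ->
  exists (c : M) (i0 i1 : Hom a c) (s : Hom c a), is_cylinder W F C i0 i1 s.
Proof.
move=> pa.
have [_ [coproducts _]] := (has_finite_colimitsE M).1 (mc_colim hM).
have [q [j0 [j1 co]]] : exists (q : M) (j0 j1 : Hom a q), is_coproduct j0 j1.
  exact: coproducts.
have Cj0 := coproduct_cofibration co pa.
have Cj1 := coproduct_cofibration (coproduct_sym co) pa.
have [h [[h0 h1] _]] := co a (idc a) (idc a).
have [[c [i [s [e Fs Ws Ci]]]] _] := mc_fact hM h.
have s0 : s \oc (i \oc j0) = idc a by rewrite compA -e.
have s1 : s \oc (i \oc j1) = idc a by rewrite compA -e.
have [Wid _ _] := mc_ids hM; have [_ _ Cc] := mc_comp hM.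
exists c, (i \oc j0), (i \oc j1), s; split=> //.
- split; first exact: Cc.
  have Wa : W (s \oc (i \oc j0)) by rewrite s0.
  by have [] := mc_23 hM Wa (or_introl Ws).
- split; first exact: Cc.
  have Wa : W (s \oc (i \oc j1)) by rewrite s1.
  by have [] := mc_23 hM Wa (or_introl Ws).
- move=> x y p Fp Wp f0 f1 H e0 e1.
  have [f [[ef0 ef1] _]] := co x f0 f1.
  have [|H' [H'i pH']] :=
    mc_lift hM (i := i) (p := p) (f := f) (g := H) _ Fp Ci (or_intror Wp).
    by apply: (coproduct_ext co); rewrite -!compA -?ef0 -?ef1.
  by exists H'; split=> //; rewrite compA H'i.
Qed.

(** Factor the map from the initial object to [x]. That [t] is also a fibration is recorded because
    maps from cofibrant objects will be lifted along it. *)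
Lemma cofibrant_replacement (x : M) : exists (a : M) (t : Hom a x),
  [/\ projective_ob W F a, F t & W t].
Proof.
have [[i iP] _] := (has_finite_colimitsE M).1 (mc_colim hM).
have [f fP] := iP x.
have [[a [j [t [e Ft Wt Cj]]]] _] := mc_fact hM (f : @Hom M i x).
exists a, t; split=> // y z p Fp Wp g.
have [u uP] := iP y; have [v vP] := iP z.
have [|h [_ hE]] := mc_lift hM (i := j) (p := p) (f := u) (g :=
  g) _ Fp Cj (or_intror Wp).
  by rewrite (vP (p \oc u : @Hom M i z)) (vP (g \oc j : @Hom M i z)).
by exists h.
Qed.
End Cofibrant.

Section Fibrant.
Variables (M : category) (W F C : mor_class M).
Hypothesis hM : is_model_category W F C.

Lemma injective_ob_op (b : M) : injective_ob W C b <->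
  @projective_ob (op M) (op_class W) (op_class C) b.
Proof. by split=> H x y; apply: H. Qed.

Lemma path_exists (b : M) : injective_ob W C b ->
  exists (q : M) (p0 p1 : Hom q b) (s : Hom b q), is_path W F C p0 p1 s.
Proof.
by move=> /injective_ob_op/(cylinder_exists (is_model_category_op hM)).
Qed.

Lemma fibrant_replacement (x : M) : exists (b : M) (s : Hom x b),
  [/\ injective_ob W C b, C s & W s].
Proof.
have [b [s [pb Cs Ws]]] := cofibrant_replacement (is_model_category_op hM) x.
by exists b, s; split=> //; apply/injective_ob_op.
Qed.
End Fibrant.

(** * Left and right homotopy *)

Section Homotopy.
Variables (M : category) (W F C : mor_class M).
Hypothesis hM : is_model_category W F C.

Section FixedCylinder.
Variables (a c : M) (i0 i1 : Hom a c) (sc : Hom c a).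
Hypothesis hc : is_cylinder W F C i0 i1 sc.

(** The cylinder is fixed once and for all; transitivity then comes from comparison with a path
    object of the target, not from gluing cylinders. *)
Definition lh (b : M) (f g : Hom a b) : Prop :=
  exists H : Hom c b, H \oc i0 = f /\ H \oc i1 = g.

Lemma lh_refl (b : M) (f : Hom a b) : lh f f.
Proof.
by exists (f \oc sc); rewrite -!compA (cyl_s0 hc) (cyl_s1 hc) compc1.
Qed.

Lemma lh_comp (b d : M) (u : Hom b d) (f g : Hom a b) :
  lh f g -> lh (u \oc f) (u \oc g).
Proof. by case=> H [<- <-]; exists (u \oc H); rewrite !compA. Qed.

Lemma lh_cancel (x y : M) (p : Hom x y) (f g : Hom a x) :
  F p -> W p -> lh (p \oc f) (p \oc g) -> lh f g.
Proof.
move=> Fp Wp [H [e0 e1]].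
by have [H' [H0 H1 _]] := cyl_lift hc Fp Wp (esym e0) (esym e1); exists H'.
Qed.

Section FixedPath.
Variables (b q : M) (p0 p1 : Hom q b) (sq : Hom b q).
Hypothesis hq : is_path W F C p0 p1 sq.

Definition rh (f g : Hom a b) : Prop :=
  exists K : Hom a q, p0 \oc K = f /\ p1 \oc K = g.

Lemma path_s0 : p0 \oc sq = idc b. Proof. exact: (cyl_s0 hq). Qed.
Lemma path_s1 : p1 \oc sq = idc b. Proof. exact: (cyl_s1 hq). Qed.

Lemma path_lift (x y : M) (j : Hom x y) : C j -> W j ->
  forall (f0 f1 : Hom y b) (K : Hom x q),
  f0 \oc j = p0 \oc K -> f1 \oc j = p1 \oc K ->
  exists K' : Hom y q, [/\ p0 \oc K' = f0, p1 \oc K' = f1 & K' \oc j = K].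
Proof. by move=> Cj Wj f0 f1 K;
  apply: (@cyl_lift _ _ _ _ _ _ _ _ _ hq y x j). Qed.

Lemma rh_refl (f : Hom a b) : rh f f.
Proof. by exists (sq \oc f); rewrite !compA path_s0 path_s1 comp1c. Qed.

(** The right homotopy [K] joins the [i0]-ends of [H] and of the constant homotopy at [h]. It
    extends along the trivial cofibration [i0] to a map from the cylinder to the path object, whose
    restriction to [i1] is the required homotopy. *)
Lemma lh_rh_euclid (f g h : Hom a b) : lh f g -> rh f h -> rh g h.
Proof.
case=> H [H0 H1] [K [K0 K1]]; have [Ci Wi] := cyl_0 hc.
have [||K' [e0 e1 _]] := path_lift Ci Wi (f0 := H) (f1 := h \oc sc) (K := K).
- by rewrite H0.
- by rewrite -compA (cyl_s0 hc) compc1.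
exists (K' \oc i1); rewrite !compA e0 e1; split=> //.
by rewrite -compA (cyl_s1 hc) compc1.
Qed.

Lemma lh_rh_trans (f g h : Hom a b) : lh f g -> rh g h -> rh f h.
Proof.
case=> H [H0 H1] [K [K0 K1]]; have [Ci Wi] := cyl_1 hc.
have [||K' [e0 e1 _]] := path_lift Ci Wi (f0 := H) (f1 := h \oc sc) (K := K).
- by rewrite H1.
- by rewrite -compA (cyl_s1 hc) compc1.
exists (K' \oc i0); rewrite !compA e0 e1; split=> //.
by rewrite -compA (cyl_s0 hc) compc1.
Qed.

(** The dual move: [H] is lifted along the trivial fibration [p1], with [K] and the constant path at
    [h] prescribed on the two ends, and the lift is composed with [p0]. *)
Lemma rh_lh_trans (f g h : Hom a b) : rh f g -> lh g h -> lh f h.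
Proof.
case=> K [K0 K1] [H [H0 H1]]; have [Fp Wp] := cyl_1 hq.
have [||H' [e0 e1 _]] := cyl_lift hc Fp Wp (f0 := K) (f1 := sq \oc h) (H := H).
- exact: etrans K1 (esym H0).
- by rewrite H1 -[RHS]comp1c -path_s1 -compA.
exists (p0 \oc H'); rewrite -!compA e0 e1; split=> //.
by rewrite compA path_s0 comp1c.
Qed.

(** Each relation is composed with the reflexivity of the other. Symmetry and transitivity of [lh]
    then follow from the mixed rules above. *)
Lemma rh_lh (f g : Hom a b) : rh f g <-> lh f g.
Proof.
split=> fg; first exact: rh_lh_trans fg (lh_refl g).
exact: lh_rh_trans fg (rh_refl g).
Qed.
End FixedPath.

Lemma lh_sym (b : M) (f g : Hom a b) : injective_ob W C b -> lh f g -> lh g f.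
Proof.
move=> /(path_exists hM)[q [p0 [p1 [s hq]]]] fg; apply/(rh_lh hq).
exact: (lh_rh_euclid hq fg (rh_refl hq f)).
Qed.

Lemma lh_trans (b : M) (f g h : Hom a b) :
  injective_ob W C b -> lh f g -> lh g h -> lh f h.
Proof.
move=> /(path_exists hM)[q [p0 [p1 [s hq]]]] fg gh; apply/(rh_lh hq).
by apply: (lh_rh_trans hq fg); apply/(rh_lh hq).
Qed.

(** The constant path at the common restriction [u \oc j] extends along the trivial cofibration [j]
    to a right homotopy from [u] to [v]. *)
Lemma lh_agree (x y b : M) (j : Hom x y) (u v : Hom y b) (f : Hom a y) :
  injective_ob W C b -> C j -> W j -> u \oc j = v \oc j ->
  lh (u \oc f) (v \oc f).
Proof.
move=> /(path_exists hM)[q [p0 [p1 [s hq]]]] Cj Wj e; apply/(rh_lh hq).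
have [||K [<- <- _]] := path_lift hq Cj Wj (f0 := u) (f1 := v) (K :=
  s \oc (u \oc j)).
- by rewrite [RHS]compA (path_s0 hq) comp1c.
- by rewrite [RHS]compA (path_s1 hq) comp1c.
by exists (K \oc f); rewrite !compA.
Qed.

Hypothesis pa : projective_ob W F a.

(* Ken Brown's factorization: a weak equivalence between fibrant objects is a
   trivial fibration after a map with a homotopy inverse. *)
Lemma lh_weq (x y : M) (w : Hom x y) :
  injective_ob W C x -> injective_ob W C y -> W w ->
  (forall f g : Hom a x, lh (w \oc f) (w \oc g) -> lh f g) /\
  (forall g : Hom a y, exists f : Hom a x, lh (w \oc f) g).
Proof.
move=> ix iy Ww; have [_ [e [j [p [we Fp Cj Wj]]]]] := mc_fact hM w.
have Wpj : W (p \oc j) by rewrite -we.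
have [Wp _] := mc_23 hM Wpj (or_intror Wj).
(* The middle object is fibrant, because [p] is a fibration to the fibrant object [y]. *)
have ie : injective_ob W C e.
  move=> u v i Ci Wi f; have [g eg] := iy _ _ i Ci Wi (p \oc f).
  have [h [hi _]] := mc_lift hM eg Fp Ci (or_introl Wi).
  by exists h.
have [r rj] := ix _ _ j Cj Wj (idc x).
split=> [f g|g].
  rewrite we -!compA => /(lh_cancel Fp Wp)/(lh_comp r).
  by rewrite !compA -rj !comp1c.
have [h ->] := pa Fp Wp g.
(* The retraction [r] of [j] is also a right inverse up to homotopy, since [j \oc r] and the
   identity of [e] agree on [j]. *)
exists (r \oc h); rewrite we -compA; apply: lh_comp.
rewrite -[X in lh _ X]comp1c compA.
by apply: (lh_agree h ie Cj Wj); rewrite -compA -rj comp1c compc1.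
Qed.
End FixedCylinder.

(* The functor x |-> [a, R x], with values in the sets of homotopy classes of
   maps from the cofibrant object a to chosen fibrant replacements, inverts
   the weak equivalences.  A set of homotopy classes is encoded by a
   homotopy-invariant predicate. *)
Section RepresentedFunctor.
Variable a : M.
Hypothesis pa : projective_ob W F a.
Variables (c : M) (i0 i1 : Hom a c) (sc : Hom c a).
Hypothesis hc : is_cylinder W F C i0 i1 sc.
Variables (R : M -> M) (r : forall x, Hom x (R x)).
Hypothesis rP : forall x, [/\ injective_ob W C (R x), C (r x) & W (r x)].
Local Notation "f ~ g" := (lh i0 i1 f g) (at level 70).

Record classes (x : M) := Classes {
  cl_pred :> Hom a (R x) -> Prop;
  cl_inv : forall f g, f ~ g -> cl_pred f -> cl_pred g }.

Lemma classes_eq (x : M) (P Q : classes x) : (forall f, P f <-> Q f) -> P = Q.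
Proof.
case: P Q => [P hP] [Q hQ] /= PQ.
have e : P = Q by apply: funext => f; apply: propext.
by case: Q / e hQ {PQ} => hQ; rewrite (Prop_irrelevance hP hQ).
Qed.

Let iR x : injective_ob W C (R x). Proof. by case: (rP x). Qed.

Definition extends (x y : M) (f : Hom x y) (u : Hom (R x) (R y)) : Prop :=
  u \oc r x = r y \oc f.

Lemma extension_exists (x y : M) (f : Hom x y) : exists u, extends f u.
Proof.
have [_ Cr Wr] := rP x.
by have [u eu] := iR (x := y) Cr Wr (r y \oc f); exists u.
Qed.

Lemma extension_uniq (x y : M) (f : Hom x y) u v (k : Hom a (R x)) :
  extends f u -> extends f v -> u \oc k ~ v \oc k.
Proof.
have [_ Cr Wr] := rP x.
by move=> eu ev; apply: (lh_agree hc k (iR (x := y)) Cr Wr); rewrite eu ev.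
Qed.

Lemma image_subproof (x y : M) (f : Hom x y) (P : classes x) g g' : g ~ g' ->
  (exists u k, [/\ extends f u, P k & u \oc k ~ g]) ->
  exists u k, [/\ extends f u, P k & u \oc k ~ g'].
Proof.
move=> gg' [u [k [eu Pk kg]]]; exists u, k; split=> //.
exact: (lh_trans hc (iR (x := y)) kg).
Qed.

(** Quantifying over all extensions [u] of [f] avoids a choice that would not be functorial;
    [imageE] then allows computing with any single one. *)
Definition image (x y : M) (f : Hom x y) (P : classes x) : classes y :=
  Classes (image_subproof (f := f) (P := P)).

Lemma imageE (x y : M) (f : Hom x y) u (P : classes x) g : extends f u ->
  image f P g <-> exists2 k, P k & u \oc k ~ g.
Proof.
move=> eu; split=> [[v [k [ev Pk kg]]]|[k Pk kg]]; last by exists u, k.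
exists k => //; apply: (lh_trans hc (iR (x := y)) _ kg).
exact: extension_uniq eu ev.
Qed.

Lemma image_id (x : M) : image (idc x) = id.
Proof.
apply: funext => P; apply: classes_eq => f.
rewrite (imageE P f (u := idc (R x))); last by rewrite /extends comp1c compc1.
split=> [[k Pk kf]|Pf]; first by apply: cl_inv Pk; rewrite comp1c in kf.
by exists f => //; rewrite comp1c; apply: (lh_refl hc).
Qed.

Lemma image_comp (x y z : M) (g : Hom y z) (f : Hom x y) :
  image (g \oc f) = image g \o image f.
Proof.
apply: funext => P; apply: classes_eq => h.
rewrite -[(_ \o _) P]/(image g (image f P)).
have [u eu] := extension_exists f; have [v ev] := extension_exists g.
have evu : extends (g \oc f) (v \oc u).
  by rewrite /extends -compA eu compA ev compA.
rewrite (imageE P h evu) (imageE (image f P) h ev); split=> [[k Pk kh]|[l]].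
  exists (u \oc k); last by rewrite compA.
  by apply/(imageE _ _ eu); exists k => //; apply: (lh_refl hc).
case/(imageE _ _ eu) => k Pk kl lh; exists k => //.
rewrite -compA; apply: (lh_trans hc (iR (x := z)) _ lh).
exact: lh_comp.
Qed.

Definition classes_category : category :=
  @Category M (fun x y => classes x -> classes y) (fun=> id)
    (fun x y z g f => g \o f) (fun _ _ _ _ _ _ _ => erefl) (fun _ _ _ => erefl)
    (fun _ _ _ => erefl).

Definition represented : functor M classes_category :=
  @Functor M classes_category id image image_id image_comp.

Lemma preimage_subproof (x y : M) (u : Hom (R x) (R y)) (Q : classes y) g g' :
  g ~ g' -> Q (u \oc g) -> Q (u \oc g').
Proof. by move=> gg'; apply: cl_inv; apply: lh_comp. Qed.

(** By two-out-of-three an extension [u] of a weak equivalence is a weak equivalence between fibrant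
    objects, hence bijective on homotopy classes by [lh_weq]. The inverse takes preimages under
    [u]. *)
Lemma represented_inverts : inverts W represented.
Proof.
move=> x y s Ws; have [u eu] := extension_exists s.
have [_ Crx Wrx] := rP x; have [_ Cry Wry] := rP y.
have [Wc _ _] := mc_comp hM.
have Wu : W u.
  have Wur : W (u \oc r x) by rewrite eu; apply: Wc.
  by have [] := mc_23 hM Wur (or_intror Wrx).
have [u_inj u_surj] := lh_weq hc pa (iR (x := x)) (iR (x := y)) Wu.
exists (fun Q => Classes (preimage_subproof (u := u) (Q := Q))).
split; apply: funext => P; apply: classes_eq => f.
  suff: image s P (u \oc f) <-> P f by [].
  rewrite (imageE P _ eu); split=> [[k Pk /u_inj]|Pf].
    by move=> kf; apply: cl_inv Pk.
  by exists f => //; apply: (lh_refl hc).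
suff: image s (Classes (preimage_subproof (u := u) (Q := P))) f <-> P f by [].
rewrite (imageE _ _ eu); split=> [[k Pk kf]|Pf];
  first exact: (cl_inv kf (Pk : P (u \oc k))).
have [k kf] := u_surj f; exists k => //=.
by apply: cl_inv Pf; apply: (lh_sym hc (iR (x := y))).
Qed.

(** A Yoneda argument: the represented functor factors through the localization, so [f] and [g] act
    alike on classes, in particular on the class [P] of [r a]. This makes [r b \oc f] and
    [r b \oc g] homotopic. *)
Lemma loc_functor_lh (b : M) (f g : Hom a b) : injective_ob W C b ->
  fmap (loc_functor W) f = fmap (loc_functor W) g -> f ~ g.
Proof.
move=> ib e.
have [Phi [PhiE _]] := localization_extension represented_inverts.
have fgE : image f = image g.
  have fmapE h : arr (fmap Phi (fmap (loc_functor W) h)) = 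
      arr (@fmap _ _ represented a b h).
    by rewrite -PhiE.
  apply: (@arr_inj classes_category a b).
  by rewrite -[LHS]fmapE e fmapE.
have [u eu] := extension_exists f; have [v ev] := extension_exists g.
have invr : forall h h', h ~ h' -> r a ~ h -> r a ~ h'.
  by move=> h h' hh' rh'; apply: (lh_trans hc (iR (x := a)) rh').
pose P : classes a := Classes invr.
have : image f P (u \oc r a).
  apply/(imageE _ _ eu); exists (r a); exact: (lh_refl hc).
rewrite fgE => /(imageE _ _ ev)[k /= rk].
(* As [b] is fibrant, [r b] has a retraction [q], which carries the homotopy back to [b]. *)
have [_ Cr Wr] := rP b; have [q qr] := ib _ _ _ Cr Wr (idc b).
move=> /(lh_trans hc (iR (x := b)) (lh_comp v rk))/(lh_comp q).
rewrite eu ev !compA -qr !comp1c; exact: (lh_sym hc ib).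
Qed.
End RepresentedFunctor.

Lemma loc_functor_left_homotopic (a b : M) (f g : Hom a b) :
  projective_ob W F a -> injective_ob W C b ->
  fmap (loc_functor W) f = fmap (loc_functor W) g -> left_homotopic W f g.
Proof.
move=> pa ib e; have [c [i0 [i1 [s hc]]]] := cylinder_exists hM pa.
pose R x := cid (fibrant_replacement hM x).
pose r x : {s : Hom x (sval (R x)) | _} := cid (svalP (R x)).
have [H [<- <-]] := loc_functor_lh pa hc (fun x => svalP (r x)) ib e.
by exists c, i0, i1, s, H; split; rewrite ?(cyl_s0 hc) ?(cyl_s1 hc) //;
  case: hc.
Qed.

End Homotopy.

(** * Recognizing the localization functor *)

Section LocalizationLike.
Variables (M : category) (W F C : mor_class M).
Hypothesis hM : is_model_category W F C.
Local Notation ob := (loc_functor W).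
Local Notation loc := (fmap (loc_functor W)).

Lemma loc_left_homotopic (a b : M) (f g : Hom a b) :
  left_homotopic W f g -> loc f = loc g.
Proof.
case=> [c [i0 [i1 [s [H [Ws s0 s1 -> ->]]]]]].
rewrite !fmapM; congr (_ \oc _).
apply: (inverse_mono (loc_functor_inverse Ws)).
by rewrite -!fmapM -s0 -s1.
Qed.

(** Seen from a cofibrant object and towards a fibrant one, a word of any length collapses to one
    morphism of [M]. The maps [t] and [s] are arbitrary, so that the induction hypothesis applies to
    the replacement of the next object. *)
Lemma localization_word (x y : M) (p : word W x y) (a b : M) (t : Hom a x)
    (s : Hom y b) : projective_ob W F a -> injective_ob W C b ->
  exists f : Hom a b,
    loc s \oc ((wclass p : Hom (ob x) (ob y)) \oc loc t) = loc f.
Proof.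
move=> pa ib.
elim: p a t s pa ib => [x'|x' y' z' f p IH|x' y' z' u Wu p IH] a t s pa ib.
- exists (s \oc t); rewrite fmapM; congr (_ \oc _).
  exact: (comp1c (loc t)).
(* Forward letter: [f \oc t] lifts along the trivial fibration [t'], and the rest of the word is
   handled from [a']. *)
- have [a' [t' [pa' Ft' Wt']]] := cofibrant_replacement hM y'.
  have [k ek] := pa _ _ t' Ft' Wt' (f \oc t).
  have [h eh] := IH a' t' s pa' ib.
  exists (h \oc k); rewrite [RHS]fmapM -eh.
  rewrite -[RHS]compA -[in RHS]compA -[in RHS]fmapM -ek fmapM.
  congr (_ \oc _); rewrite [RHS]compA; congr (_ \oc _).
  by rewrite /= wc_compE.
- have [a' [t' [pa' Ft' Wt']]] := cofibrant_replacement hM y'.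
  have [h eh] := IH a' t' s pa' ib.
  (* Backward letter: [u \oc t'] is a weak equivalence, hence factors as a trivial cofibration [j]
     and a trivial fibration [q]. Then [t] lifts along [q] to [k], and [h] extends along [j] to
     [l]. *)
  have [_ [e [j [q [ej Fq Cj Wj]]]]] := mc_fact hM (u \oc t').
  have [Wc _ _] := mc_comp hM.
  have Wqj : W (q \oc j) by rewrite -ej; apply: Wc.
  have [Wq _] := mc_23 hM Wqj (or_intror Wj).
  have [k ek] := pa _ _ q Fq Wq t.
  have [l el] := ib _ _ j Cj Wj h.
  exists (l \oc k).
  pose j' : Hom (ob e) (ob a') := wclass (wbwd1 Wj).
  pose u' : Hom (ob x') (ob y') := wclass (wbwd1 Wu).
  have ij : inverse (loc j) j' by apply: loc_functor_inverse.
  have iu : inverse (loc u) u' by apply: loc_functor_inverse.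
  have ut : u' \oc loc t = loc t' \oc (j' \oc loc k).
    apply: (inverse_mono iu).
    rewrite compA iu.2 comp1c compA -fmapM ej fmapM -compA ek fmapM.
    by congr (_ \oc _); rewrite compA ij.2 comp1c.
  have -> : wclass (wbwd Wu p) = (wclass p : Hom (ob y') (ob z')) \oc u'.
    by rewrite /= wc_compE.
  rewrite -[(_ \oc u') \oc _]compA ut.
  rewrite [X in _ \oc X]compA compA eh el fmapM.
  by rewrite -compA [X in _ \oc X]compA ij.2 comp1c fmapM.
Qed.

Record loc_like (L : category) (G : functor M L) : Prop := LocLike {
  ll_inj : forall a b : M, G a = G b -> a = b;
  ll_surj : forall y : L, exists a : M, G a = y;
  ll_inverts : inverts W G;
  ll_frac : forall (a b : M) (m : Hom (G a) (G b)),
    exists (x y : M) (t : Hom x a) (s : Hom b y) (f : Hom x y),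
    [/\ W t, W s & fmap G s \oc (m \oc fmap G t) = fmap G f];
  ll_htpy : forall (a b : M) (f g : Hom a b), projective_ob W F a ->
    injective_ob W C b -> fmap G f = fmap G g -> left_homotopic W f g }.

Lemma loc_functor_like : loc_like (loc_functor W).
Proof.
split=> //.
- by move=> y; exists y.
- by move=> a b s Ws; exists (wclass (wbwd1 Ws)); apply: loc_functor_inverse.
- move=> a b m; have [p ->] := wclassP m.
  have [x [t [px _ Wt]]] := cofibrant_replacement hM a.
  have [y [s [iy _ Ws]]] := fibrant_replacement hM b.
  have [f ef] := localization_word p t s px iy.
  by exists x, y, t, s, f.
- exact: (loc_functor_left_homotopic hM).
Qed.

(** An isomorphism preserves all clauses, so they hold for whatever copy of the localization [Ho]
    has selected. *)
Lemma loc_like_comp (L : category) (Phi : functor (localization W) L) :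
  functor_iso Phi -> loc_like (functor_comp Phi (loc_functor W)).
Proof.
move=> iso; have [Phi_inj Phi_surj] := functor_iso_ob_bijective iso.
have Phi_faith := functor_iso_faithful iso.
have Phi_full := functor_iso_full iso.
split=> [a b|y|a b s Ws|a b m|a b f g pa ib].
- exact: Phi_inj.
- exact: Phi_surj.
- exists (fmap Phi (wclass (wbwd1 Ws))).
  exact: inverse_fmap (loc_functor_inverse Ws).
- have [m' <-] := Phi_full _ _ m.
  have [x [y [t [s [f [Wt Ws e]]]]]] := ll_frac loc_functor_like m'.
  by exists x, y, t, s, f; split=> //=; rewrite -!fmapM e.
- by move=> /Phi_faith; apply: (ll_htpy loc_functor_like).
Qed.

(** The comparison functor is full because the inverted maps of a fraction can be cancelled already
    in the localization; it is faithful by [localization_word] together with the clause on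
    homotopies. *)
Lemma loc_like_iso (L : category) (G : functor M L) : loc_like G ->
  exists Phi : functor (localization W) L,
    functor_iso Phi /\ functor_comp Phi (loc_functor W) = G.
Proof.
move=> like; have [Phi [PhiG _]] := localization_extension (ll_inverts like).
case: _ / PhiG like => like; exists Phi; split=> //.
apply: full_faithful_functor_iso.
- by split; [exact: (ll_inj like)|exact: (ll_surj like)].
- move=> a b m.
  have [x [y [t [s [f [Wt Ws e]]]]]] :=
    ll_frac like (m : Hom (functor_comp Phi (loc_functor W) a) (functor_comp
      Phi (loc_functor W) b)).
  pose t' : Hom (ob a) (ob x) := wclass (wbwd1 Wt).
  pose s' : Hom (ob y) (ob b) := wclass (wbwd1 Ws).
  have it : inverse (loc t) t' by apply: loc_functor_inverse.
  have is_ : inverse (loc s) s' by apply: loc_functor_inverse.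
  exists (s' \oc (loc f \oc t')).
  apply: (inverse_epi (inverse_fmap Phi it)).
  apply: (inverse_mono (inverse_fmap Phi is_)).
  rewrite -[RHS]/(fmap (functor_comp Phi (loc_functor W)) s \oc
    (m \oc fmap (functor_comp Phi (loc_functor W)) t)) e /= -!fmapM;
      congr (fmap Phi _).
  by rewrite compA compA is_.2 comp1c -compA it.1 compc1.
(* Two words with the same image become maps [f] and [g] between the same cofibrant and fibrant
   objects. These are equal in [L], hence homotopic, hence equal in the localization. *)
- move=> a b P Q; have [p ->] := wclassP P; have [q ->] := wclassP Q => e.
  have [x [t [px _ Wt]]] := cofibrant_replacement hM a.
  have [y [s [iy _ Ws]]] := fibrant_replacement hM b.
  have [f ef] := localization_word p t s px iy.
  have [g eg] := localization_word q t s px iy.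
  apply: (inverse_epi (loc_functor_inverse Wt)).
  apply: (inverse_mono (loc_functor_inverse Ws)).
  rewrite ef eg; apply: loc_left_homotopic; apply: (ll_htpy like) => //.
  rewrite -[LHS]/(fmap Phi (loc f)) -[RHS]/(fmap Phi (loc g)).
  by rewrite -ef -eg !fmapM e.
Qed.
End LocalizationLike.

(** * Bounded formulas *)

(* First-order statements are written once, over an abstract interface to the
   connectives, and then instantiated twice: in [syn] they are formulas, in
   [sem V] they are propositions about V.  A variable of [syn] is a de Bruijn
   level, stored as the function from the current depth to its index. *)
Record logic := Logic {
  tm : Type;
  fm : Type;
  Fmem : tm -> tm -> fm;
  Feq : tm -> tm -> fm;
  Fnot : fm -> fm;
  Fand : fm -> fm -> fm;
  For : fm -> fm -> fm;
  Fimp : fm -> fm -> fm;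
  Fall : tm -> (tm -> fm) -> fm;
  Fex : tm -> (tm -> fm) -> fm }.

Definition sem (S : Type) (V : superstructure S) : logic :=
  @Logic V Prop (@smem S V) (fun x y => x = y) not and or
    (fun p q => p -> q) (fun t p => forall x, smem x t -> p x)
    (fun t p => exists2 x, smem x t & p x).

Definition syn : logic :=
  @Logic (nat -> nat) (nat -> formula)
    (fun x y d => FMem (x d) (y d)) (fun x y d => FEq (x d) (y d))
    (fun p d => FNot (p d)) (fun p q d => FAnd (p d) (q d))
    (fun p q d => FOr (p d) (q d)) (fun p q d => FImp (p d) (q d))
    (fun t p d => FAll (t d) (p (fun d' => d' - d.+1) d.+1))
    (fun t p d => FEx (t d) (p (fun d' => d' - d.+1) d.+1)).

(** Below [d] binders the index of a free variable is shifted by [d]. *)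
Definition free_var (i : nat) : tm syn := fun d => d + i.

Notation "p /\' q" := (Fand p q) (at level 80, right associativity).
Notation "p \/' q" := (For p q) (at level 85, right associativity).
Notation "p ->' q" := (Fimp p q) (at level 99, right associativity).

(** A [category_code] over any type of terms, since the terms of [syn] are not elements of a
    superstructure. *)
Record code (T : Type) := Code {
  k_obj : T; k_mor : T; k_src : T; k_tgt : T; k_id : T; k_comp : T }.

Section SetStatements.
Variable L : logic.
Implicit Types x y z t r : tm L.

Definition f_upair t x y : fm L :=
  Fall t (fun s => Feq s x \/' Feq s y) /\' Fmem x t /\' Fmem y t.

Definition f_pair z x y : fm L :=
  Fall z (fun t => f_upair t x x \/' f_upair t x y) /\'
  Fex z (fun t => f_upair t x x) /\' Fex z (fun t => f_upair t x y).

Definition f_related r x y : fm L := Fex r (fun z => f_pair z x y).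

(** The tail [p] of a Kuratowski pair [z] is an element of an element [t] of [z]; this keeps the
    quantifiers bounded. *)
Fixpoint f_tuple z x (xs : seq (tm L)) : fm L :=
  match xs with
  | [::] => Feq z x
  | y :: ys => Fex z (fun t => Fex t (fun p => f_tuple p y ys /\' f_pair z x p))
  end.
End SetStatements.

(* The same two-level device for categories: statements about a category refer
   to objects and morphisms only through the following operations. *)
Record clogic (L : logic) := CLogic {
  cob : Type;
  chom : cob -> cob -> Type;
  all_ob : (cob -> fm L) -> fm L;
  ex_ob : (cob -> fm L) -> fm L;
  all_hom : forall a b, (chom a b -> fm L) -> fm L;
  ex_hom : forall a b, (chom a b -> fm L) -> fm L;
  eq_ob : cob -> cob -> fm L;
  eq_hom : forall a b, chom a b -> chom a b -> fm L;
  is_id : forall a, chom a a -> fm L;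
  is_comp : forall a b c, chom b c -> chom a b -> chom a c -> fm L }.

Arguments chom {L} K a b : rename.
Arguments all_ob {L} K p : rename.
Arguments ex_ob {L} K p : rename.
Arguments all_hom {L} K a b p : rename.
Arguments ex_hom {L} K a b p : rename.
Arguments is_id {L} K a e : rename.
Arguments is_comp {L K a b c} g f h : rename.

Definition op_clogic (L : logic) (K : clogic L) : clogic L :=
  @CLogic L (cob K) (fun a b => chom K b a) (@all_ob L K) (@ex_ob L K)
    (fun a b => @all_hom L K b a) (fun a b => @ex_hom L K b a) (@eq_ob L K)
    (fun a b => @eq_hom L K b a) (is_id K)
    (fun a b c g f h => @is_comp L K c b a f g h).

Section CategoryStatements.
Variables (L : logic) (K : clogic L).

Definition f_terminal : fm L :=
  ex_ob K (fun t => all_ob K (fun x => ex_hom K x t (fun f =>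
  all_hom K x t (fun g => eq_hom g f)))).

Definition f_products : fm L :=
  all_ob K (fun a => all_ob K (fun b => ex_ob K (fun p =>
  ex_hom K p a (fun p0 => ex_hom K p b (fun p1 =>
  all_ob K (fun x => all_hom K x a (fun f0 => all_hom K x b (fun f1 =>
  ex_hom K x p (fun h => (is_comp p0 h f0 /\' is_comp p1 h f1) /\'
    all_hom K x p (fun k => is_comp p0 k f0 ->' is_comp p1 k f1 ->'
      eq_hom k h)))))))))).

(** Composition is available only as a relation, so two equal composites are expressed by letting
    [d] range over the values of one and requiring it to be a value of the other. *)
Definition f_equalizers : fm L :=
  all_ob K (fun a => all_ob K (fun b => all_hom K a b (fun f =>
  all_hom K a b (fun g => ex_ob K (fun e => ex_hom K e a (fun i =>
  all_hom K e b (fun d => is_comp f i d ->' is_comp g i d) /\'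
  all_ob K (fun x => all_hom K x a (fun j =>
    all_hom K x b (fun d => is_comp f j d ->' is_comp g j d) ->'
    ex_hom K x e (fun h => is_comp i h j /\'
      all_hom K x e (fun k => is_comp i k j ->' eq_hom k h)))))))))).

Definition f_limits : fm L := f_terminal /\' f_products /\' f_equalizers.

Definition clclass := forall a b, chom K a b -> fm L.

Definition f_ids (X : clclass) : fm L :=
  all_ob K (fun a => all_hom K a a (fun i => is_id _ _ i ->' X _ _ i)).

Definition f_closed (X : clclass) : fm L :=
  all_ob K (fun a => all_ob K (fun b => all_ob K (fun c =>
  all_hom K b c (fun g => all_hom K a b (fun f => all_hom K a c (fun h =>
  is_comp g f h ->' X _ _ g ->' X _ _ f ->' X _ _ h)))))).

Definition f_two_of_three (X : clclass) : fm L :=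
  all_ob K (fun a => all_ob K (fun b => all_ob K (fun c =>
  all_hom K b c (fun f => all_hom K a b (fun g => all_hom K a c (fun h =>
  is_comp f g h ->' X _ _ h ->' X _ _ f \/' X _ _ g ->'
  X _ _ f /\' X _ _ g)))))).

Definition f_retract (X : clclass) : fm L :=
  all_ob K (fun a => all_ob K (fun b => all_ob K (fun c => all_ob K (fun d =>
  all_hom K a b (fun f => all_hom K c d (fun g =>
  all_hom K a c (fun i => all_hom K c a (fun r =>
  all_hom K b d (fun j => all_hom K d b (fun s =>
  all_hom K a a (fun e => is_id _ _ e ->' is_comp r i e ->'
  all_hom K b b (fun e' => is_id _ _ e' ->' is_comp s j e' ->'
  all_hom K a d (fun k => is_comp g i k ->' is_comp j f k ->'
  all_hom K c b (fun l => is_comp f r l ->' is_comp s g l ->'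
  X _ _ g ->' X _ _ f)))))))))))))).

Definition f_lifting (W F C : clclass) : fm L :=
  all_ob K (fun a => all_ob K (fun b => all_ob K (fun x => all_ob K (fun y =>
  all_hom K a b (fun i => all_hom K x y (fun p =>
  all_hom K a x (fun f => all_hom K b y (fun g =>
  all_hom K a y (fun k => is_comp p f k ->' is_comp g i k ->'
  F _ _ p ->' C _ _ i ->' W _ _ i \/' W _ _ p ->'
  ex_hom K b x (fun h => is_comp h i f /\' is_comp p h g)))))))))).

Definition f_factorization (W F C : clclass) : fm L :=
  all_ob K (fun a => all_ob K (fun b => all_hom K a b (fun f =>
  ex_ob K (fun x => ex_hom K a x (fun i => ex_hom K x b (fun p =>
    is_comp p i f /\' F _ _ p /\' W _ _ p /\' C _ _ i))) /\'
  ex_ob K (fun x => ex_hom K a x (fun i => ex_hom K x b (fun p =>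
    is_comp p i f /\' F _ _ p /\' C _ _ i /\' W _ _ i)))))).

Definition f_projective (W F : clclass) (a : cob K) : fm L :=
  all_ob K (fun x => all_ob K (fun y => all_hom K x y (fun p =>
  F _ _ p ->' W _ _ p ->' all_hom K a y (fun f =>
  ex_hom K a x (fun h => is_comp p h f))))).

Definition f_injective (W C : clclass) (b : cob K) : fm L :=
  all_ob K (fun x => all_ob K (fun y => all_hom K x y (fun i =>
  C _ _ i ->' W _ _ i ->' all_hom K x b (fun f =>
  ex_hom K y b (fun h => is_comp h i f))))).

Definition f_left_homotopic (W : clclass) a b (f g : chom K a b) : fm L :=
  ex_ob K (fun c => ex_hom K a c (fun i0 => ex_hom K a c (fun i1 =>
  ex_hom K c a (fun s => ex_hom K c b (fun H => W _ _ s /\'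
  all_hom K a a (fun e => is_id _ _ e ->' is_comp s i0 e /\' is_comp s i1 e) /\'
  is_comp H i0 f /\' is_comp H i1 g))))).
End CategoryStatements.

Definition f_model (L : logic) (K : clogic L) (W F C : clclass K) : fm L :=
  f_limits K /\' f_limits (op_clogic K) /\'
  (f_ids W /\' f_ids F /\' f_ids C) /\'
  (f_closed W /\' f_closed F /\' f_closed C) /\'
  f_two_of_three W /\' (f_retract W /\' f_retract F /\' f_retract C) /\'
  f_lifting W F C /\' f_factorization W F C.

Section LocalizationStatement.
Variables (L : logic) (K K' : clogic L).
Variable W F C : clclass K.
Variable g0 : cob K -> cob K' -> fm L.
Variable g1 : forall a b a' b', chom K a b -> chom K' a' b' -> fm L.

Definition f_ob_inj : fm L :=
  all_ob K (fun a => all_ob K (fun b => all_ob K' (fun y =>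
  g0 a y ->' g0 b y ->' eq_ob a b))).

Definition f_ob_surj : fm L :=
  all_ob K' (fun y => ex_ob K (fun a => g0 a y)).

Definition f_inverts : fm L :=
  all_ob K (fun a => all_ob K (fun b => all_hom K a b (fun s => W s ->'
  all_ob K' (fun a' => g0 a a' ->' all_ob K' (fun b' => g0 b b' ->'
  all_hom K' a' b' (fun s' => g1 s s' ->' ex_hom K' b' a' (fun t =>
    all_hom K' a' a' (fun e => is_id _ _ e ->' is_comp t s' e) /\'
    all_hom K' b' b' (fun e => is_id _ _ e ->' is_comp s' t e)))))))).

Definition f_fractions : fm L :=
  all_ob K (fun a => all_ob K (fun b =>
  all_ob K' (fun a' => g0 a a' ->' all_ob K' (fun b' => g0 b b' ->'
  all_hom K' a' b' (fun m =>
  ex_ob K (fun x => ex_ob K (fun y =>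
  ex_hom K x a (fun t => ex_hom K b y (fun s => ex_hom K x y (fun f =>
  W t /\' W s /\' ex_ob K' (fun x' => ex_ob K' (fun y' =>
  ex_hom K' x' a' (fun t' => ex_hom K' b' y' (fun s' =>
  ex_hom K' x' y' (fun f' => g1 t t' /\' g1 s s' /\' g1 f f' /\'
  ex_hom K' x' b' (fun n => is_comp m t' n /\' is_comp s' n f')))))))))))))))).

Definition f_homotopies : fm L :=
  all_ob K (fun a => all_ob K (fun b =>
  all_hom K a b (fun f => all_hom K a b (fun g =>
  f_projective W F a ->' f_injective W C b ->'
  all_ob K' (fun a' => all_ob K' (fun b' => all_hom K' a' b' (fun h =>
  g1 f h ->' g1 g h ->' f_left_homotopic W f g))))))).

Definition f_loc_like : fm L :=
  f_ob_inj /\' f_ob_surj /\' f_inverts /\' f_fractions /\' f_homotopies.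
End LocalizationStatement.

(** * Statements about categories coded by sets *)

Section CodedStatements.
Variables (L : logic) (u eps I : tm L).

Definition f_ob (c : code (tm L)) (x : tm L) : fm L :=
  f_related eps x (k_obj c).
Definition f_mor (c : code (tm L)) (f : tm L) : fm L :=
  f_related eps f (k_mor c).
Definition f_hom (c : code (tm L)) (f x y : tm L) : fm L :=
  f_mor c f /\' f_related (k_src c) f x /\' f_related (k_tgt c) f y.

(** Objects and morphisms are individuals that belong to the code through [eps], so quantifiers are
    bounded by [I]. Morphisms are untyped terms; source and target are enforced by the quantifiers
    over them. *)
Definition code_clogic (c : code (tm L)) : clogic L :=
  @CLogic L (tm L) (fun _ _ => tm L)
    (fun p => Fall I (fun x => f_ob c x ->' p x))
    (fun p => Fex I (fun x => f_ob c x /\' p x))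
    (fun x y p => Fall I (fun f => f_hom c f x y ->' p f))
    (fun x y p => Fex I (fun f => f_hom c f x y /\' p f))
    (@Feq L) (fun _ _ => @Feq L) (fun x f => f_related (k_id c) x f)
    (fun _ _ _ g f h => Fex (k_comp c) (fun z => f_tuple z g [:: f; h])).

(** Being a set means not being an individual. Besides the axioms, each graph is required to contain
    only legitimate entries, as the equivalences in [reads] demand. *)
Definition f_category (c : code (tm L)) : fm L :=
  let K := code_clogic c in
  (Fmem (k_obj c) u /\' Fmem (k_mor c) u) /\'
  (Fnot (Fmem (k_src c) I) /\' Fnot (Fmem (k_tgt c) I) /\'
   Fnot (Fmem (k_id c) I) /\' Fnot (Fmem (k_comp c) I)) /\'
  Fall (k_src c) (fun z => ex_ob K (fun x => ex_ob K (fun y =>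
    ex_hom K x y (fun f => f_pair z f x)))) /\'
  Fall (k_tgt c) (fun z => ex_ob K (fun x => ex_ob K (fun y =>
    ex_hom K x y (fun f => f_pair z f y)))) /\'
  Fall (k_id c) (fun z => ex_ob K (fun x => ex_hom K x x (fun f =>
    f_pair z x f))) /\'
  Fall (k_comp c) (fun z => ex_ob K (fun x => ex_ob K (fun y =>
    ex_ob K (fun w =>
    ex_hom K y w (fun g => ex_hom K x y (fun f => ex_hom K x w (fun h =>
    f_tuple z g [:: f; h]))))))) /\'
  Fall I (fun f => f_mor c f ->' ex_ob K (fun x => ex_ob K (fun y =>
    f_hom c f x y /\' all_ob K (fun x' => all_ob K (fun y' =>
    f_hom c f x' y' ->' Feq x' x /\' Feq y' y))))) /\'
  all_ob K (fun x => ex_hom K x x (fun e => f_related (k_id c) x e /\'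
    all_hom K x x (fun e' => f_related (k_id c) x e' ->' Feq e' e) /\'
    all_ob K (fun y => all_hom K x y (fun f => @is_comp L K x x y f e f)) /\'
    all_ob K (fun y => all_hom K y x (fun f => @is_comp L K y x x e f f)))) /\'
  all_ob K (fun x => all_ob K (fun y => all_ob K (fun w =>
    all_hom K y w (fun g => all_hom K x y (fun f => ex_hom K x w (fun h =>
    @is_comp L K x y w g f h /\' all_hom K x w (fun h' =>
    @is_comp L K x y w g f h' ->' Feq h' h))))))) /\'
  all_ob K (fun x => all_ob K (fun y => all_ob K (fun w => all_ob K (fun v =>
    all_hom K w v (fun h => all_hom K y w (fun g => all_hom K x y (fun f =>
    all_hom K x w (fun gf => all_hom K y v (fun hg => all_hom K x v (fun l =>
    @is_comp L K x y w g f gf ->' @is_comp L K y w v h g hg ->'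
    @is_comp L K x w v h gf l ->' @is_comp L K x y v hg f l)))))))))).

Definition f_class (c : code (tm L)) (w : tm L) : fm L :=
  let K := code_clogic c in
  Fnot (Fmem w I) /\' Fall w (fun x => ex_ob K (fun a => ex_ob K (fun b =>
    ex_hom K a b (fun f => Feq x f)))).

Definition f_functor (c d : code (tm L)) (g0 g1 : tm L) : fm L :=
  let K := code_clogic c in let K' := code_clogic d in
  (Fnot (Fmem g0 I) /\' Fnot (Fmem g1 I)) /\'
  Fall g0 (fun z => ex_ob K (fun a => ex_ob K' (fun a' => f_pair z a a'))) /\'
  Fall g1 (fun z => ex_ob K (fun a => ex_ob K (fun b => ex_hom K a b (fun f =>
    ex_ob K' (fun a' => ex_ob K' (fun b' => ex_hom K' a' b' (fun f' =>
    f_related g0 a a' /\' f_related g0 b b' /\' f_pair z f f'))))))) /\'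
  all_ob K (fun a => ex_ob K' (fun a' => f_related g0 a a' /\'
    all_ob K' (fun a'' => f_related g0 a a'' ->' Feq a'' a'))) /\'
  all_ob K (fun a => all_ob K (fun b => all_hom K a b (fun f =>
    all_ob K' (fun a' => f_related g0 a a' ->'
    all_ob K' (fun b' => f_related g0 b b' ->'
    ex_hom K' a' b' (fun f' => f_related g1 f f' /\'
    all_hom K' a' b' (fun f'' => f_related g1 f f'' ->' Feq f'' f'))))))) /\'
  all_ob K (fun a => all_hom K a a (fun e => is_id K a e ->'
    all_ob K' (fun a' => f_related g0 a a' ->' all_hom K' a' a' (fun e' =>
    f_related g1 e e' ->' is_id K' a' e')))) /\'
  all_ob K (fun a => all_ob K (fun b => all_ob K (fun d =>
    all_hom K b d (fun g => all_hom K a b (fun f => all_hom K a d (fun h =>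
    @is_comp L K a b d g f h ->'
    all_ob K' (fun a' => f_related g0 a a' ->'
    all_ob K' (fun b' => f_related g0 b b' ->'
    all_ob K' (fun d' => f_related g0 d d' ->'
    all_hom K' b' d' (fun g' => f_related g1 g g' ->'
    all_hom K' a' b' (fun f' => f_related g1 f f' ->'
    all_hom K' a' d' (fun h' => f_related g1 h h' ->'
    @is_comp L K' a' b' d' g' f' h')))))))))))).

(* Every model category with code in [B] has a value under [Ho] which is
   isomorphic to its localization, as far as this can be said in first-order
   terms. *)
Definition f_homotopy (Ho B : tm L) : fm L :=
  Fall B (fun o => Fall B (fun a => Fall B (fun s => Fall B (fun t =>
  Fall B (fun i => Fall B (fun k =>
  Fall B (fun w => Fall B (fun f => Fall B (fun c =>
  let m := Code o a s t i k in let K := code_clogic m in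
  f_category m /\' (f_class m w /\' f_class m f /\' f_class m c) /\'
  f_model (K := K) (fun _ _ x => Fmem x w) (fun _ _ x => Fmem x f)
    (fun _ _ x => Fmem x c) ->'
  Fex B (fun zm => Fex B (fun v => Fex B (fun zl => Fex B (fun g =>
  Fex B (fun o' => Fex B (fun a' => Fex B (fun s' => Fex B (fun t' =>
  Fex B (fun i' => Fex B (fun k' =>
  Fex B (fun g0 => Fex B (fun g1 => Fex B (fun zc =>
  let l := Code o' a' s' t' i' k' in let K' := code_clogic l in
  f_tuple zc o [:: a; s; t; i; k] /\' f_tuple zm zc [:: w; f; c] /\'
  f_related Ho zm v /\' f_pair v zl g /\'
  f_tuple zl o' [:: a'; s'; t'; i'; k'] /\' f_pair g g0 g1 /\'
  f_category l /\' f_functor m l g0 g1 /\'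
  f_loc_like (K := K) (K' := K') (fun _ _ x => Fmem x w)
    (fun _ _ x => Fmem x f) (fun _ _ x => Fmem x c)
    (f_related g0) (fun _ _ _ _ => f_related g1))))))))))))))))))))))).
End CodedStatements.

(** Evaluating the [syn] instance with [holds] computes to the [sem] instance, in both
    superstructures, so transfer applies without any translation lemma. *)
Lemma transfer_homotopy (S S' : Type) (V : superstructure S)
    (V' : superstructure S') (star : V -> V') (u eps I Ho B : V) :
  is_enlargement star -> @f_homotopy (sem V) u eps I Ho B ->
  @f_homotopy (sem V') (star u) (star eps) (star I) (star Ho) (star B).
Proof.
move=> enl.
pose e (i : nat) : V :=
  match i with 0 => u | 1 => eps | 2 => I | 3 => Ho | _ => B end.
have := (star_transfer enl (@f_homotopy syn (free_var 0) (free_var 1)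
  (free_var 2) (free_var 3) (free_var 4) 0) e).1.
exact.
Qed.

(** * Interpretation of the formulas *)

Section Superstructure.
Variables (S : Type) (V : superstructure S).
Implicit Types x y z t r : V.
Local Notation in_V := (in_stage (@smem S V) (@atom S V)).

Lemma in_stage_leq n m x : n <= m -> in_V n x -> in_V m x.
Proof.
by move=> /subnK <-; elim: (m - n) => // k IH xn; left; apply: IH.
Qed.

Lemma in_stage_smem n x y : in_V n y -> smem x y -> in_V n x.
Proof.
elim: n => [[s ->] xs|n IH [yn xy|[_ yP] xy]]; first by case: (smem_atom xs).
- by left; apply: IH yn xy.
- by left; apply: yP.
Qed.

Lemma member_is_set x y : smem x y -> is_set y.
Proof. by move=> xy s e; apply: (@smem_atom _ V s x); rewrite -e. Qed.

Lemma is_setE x : is_set x <-> ~ smem x (individuals V).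
Proof.
split=> [xs /subset_ofP[[s e] _]|xI s e]; first exact: xs e.
by apply: xI; apply/subset_ofP; split=> //; exists s.
Qed.

Lemma upair_exists x y : exists t, is_upair t x y.
Proof.
have [n xn] := sset_stage x; have [m ym] := sset_stage y.
exists (subset_of (maxn n m) (fun t => t = x \/ t = y)) => t.
rewrite subset_ofP; split=> [[]//|e]; split=> //; case: e => ->.
- exact: in_stage_leq (leq_maxl _ _) xn.
- exact: in_stage_leq (leq_maxr _ _) ym.
Qed.

Lemma upair_is_set t x y : is_upair t x y -> is_set t.
Proof. by move=> tP; apply: (@member_is_set x); apply/tP; left. Qed.

Lemma upair_uniq t t' x y : is_upair t x y -> is_upair t' x y -> t = t'.
Proof.
move=> tP t'P; apply: sset_ext => [||s]; try exact: upair_is_set.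
by rewrite tP t'P.
Qed.

Lemma pair_exists x y : exists z, is_pair z x y.
Proof.
have [t tP] := upair_exists x x; have [t' t'P] := upair_exists x y.
have [z zP] := upair_exists t t'; exists z => s; rewrite zP; split.
- by case=> ->; [left|right].
- by case=> [/upair_uniq|/upair_uniq] e; [left|right]; apply: e.
Qed.

Lemma pair_uniq z z' x y : is_pair z x y -> is_pair z' x y -> z = z'.
Proof.
have [t tP] := upair_exists x x => zP z'P.
apply: sset_ext => [||s]; last by rewrite zP z'P.
- by apply: (@member_is_set t); apply/zP; left.
- by apply: (@member_is_set t); apply/z'P; left.
Qed.

Lemma pair_inj z x y x' y' :
  is_pair z x y -> is_pair z x' y' -> x = x' /\ y = y'.
Proof.
move=> zP zP'.
have [t tP] := upair_exists x x; have [u uP] := upair_exists x y.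
have [t' tP'] := upair_exists x' x'; have [u' uP'] := upair_exists x' y'.
have memP (v w v' w' s s' : V) : is_upair s v w -> is_upair s' v' w' ->
  s = s' ->
    [/\ v = v' \/ v = w', w = v' \/ w = w', v' = v \/ v' = w &
      w' = v \/ w' = w].
  move=> sP sP' e; split.
  - by apply/sP'; rewrite -e; apply/sP; left.
  - by apply/sP'; rewrite -e; apply/sP; right.
  - by apply/sP; rewrite e; apply/sP'; left.
  - by apply/sP; rewrite e; apply/sP'; right.
have ex : x = x'.
  have : smem t z by apply/zP; left.
  case/zP' => [tx|tx]; first by have [[]] := memP _ _ _ _ _ _ tP tx erefl.
  by have [_ _ [] ->] := memP _ _ _ _ _ _ tP tx erefl.
case: x' / ex zP' tP' uP' => zP' tP' uP'; split=> //.
have : smem u z by apply/zP; right.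
have : smem u' z by apply/zP'; right.
case/zP => [ux|ux].
  have [_ _ _ ey'] := memP _ _ _ _ _ _ ux uP' erefl.
  have {}ey' : y' = x by have [_ [] ->] := memP _ _ _ _ _ _ uP' ux erefl.
  case/zP' => [uy|uy]; last by have [_ [] ->] := memP _ _ _ _ _ _ uP uy erefl;
    rewrite ?ey'.
  by have [_ [] ->] := memP _ _ _ _ _ _ uP uy erefl; rewrite ey'.
have [_ e1 _ e2] := memP _ _ _ _ _ _ uP' ux erefl.
by move=> _; case: e1 => e1; case: e2 => e2; rewrite ?e1 ?e2 // -e2 e1.
Qed.

Lemma f_upairE t x y : @f_upair (sem V) t x y <-> is_upair t x y.
Proof.
split=> [[tP [xt yt]] s|tP]; first by split; [apply: tP|case=> ->].
split; first by move=> s /tP.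
by split; apply/tP; [left|right].
Qed.

Lemma f_pairE z x y : @f_pair (sem V) z x y <-> is_pair z x y.
Proof.
split=> [[zP [[t tz /f_upairE tP] [t' tz' /f_upairE tP']]] s|zP].
  split=> [/zP[/f_upairE|/f_upairE]|[sP|sP]]; [by left|by right| |].
  - by rewrite (upair_uniq sP tP).
  - by rewrite (upair_uniq sP tP').
split; first by move=> s /zP[/f_upairE|/f_upairE]; [left|right].
have [t tP] := upair_exists x x; have [t' tP'] := upair_exists x y.
split; [exists t; last exact/f_upairE|exists t'; last exact/f_upairE].
- by apply/zP; left.
- by apply/zP; right.
Qed.

Lemma f_relatedE r x y : @f_related (sem V) r x y <-> related r x y.
Proof. by split=> -[z zr /f_pairE zP]; exists z. Qed.

Lemma pair_second z x y : is_pair z x y -> exists2 t, smem t z & smem y t.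
Proof.
have [t tP] := upair_exists x y => zP; exists t; first by apply/zP; right.
by apply/tP; right.
Qed.

Lemma pair_first z x y : is_pair z x y -> exists2 t, smem t z & smem x t.
Proof.
have [t tP] := upair_exists x y => zP; exists t; first by apply/zP; right.
by apply/tP; left.
Qed.

Lemma f_tupleE z x (ys : seq V) : @f_tuple (sem V) z x ys <-> is_tuple z x ys.
Proof.
elim: ys z x => [//|y ys IH] z x; split=> /=.
- by case=> t _ [p _ [/IH pP /f_pairE zP]]; exists p.
- case=> p /IH pP zP; have [t tz pt] := pair_second zP.
  by exists t => //; exists p => //; split=> //; apply/f_pairE.
Qed.

Lemma tuple_exists x (ys : seq V) : exists z, is_tuple z x ys.
Proof.
elim: ys x => [|y ys IH] x; first by exists x.
by have [p pP] := IH y; have [z zP] := pair_exists x p; exists z, p.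
Qed.

Lemma tuple_uniq z z' x (ys : seq V) :
  is_tuple z x ys -> is_tuple z' x ys -> z = z'.
Proof.
elim: ys z z' x => [|y ys IH] z z' x /=; first by move=> -> ->.
case=> p pP zP [p' pP' zP']; move: zP'; rewrite -(IH _ _ _ pP pP').
exact: pair_uniq.
Qed.

Lemma tuple_inj z x x' (ys ys' : seq V) : size ys = size ys' ->
  is_tuple z x ys -> is_tuple z x' ys' -> x :: ys = x' :: ys'.
Proof.
elim: ys ys' z x x' => [|y ys IH] [|y' ys'] z x x' //= => [_ -> -> //|[e]].
case=> p pP zP [p' pP' zP']; have [-> ep] := pair_inj zP zP'.
by rewrite -ep in pP'; rewrite (IH _ _ _ _ e pP pP').
Qed.

Lemma in_stage_pair n z x y : in_V n z -> is_pair z x y -> in_V n x /\ in_V n y.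
Proof.
move=> zn zP; have [t tz xt] := pair_first zP;
  have [t' tz' yt'] := pair_second zP.
split; first exact: in_stage_smem (in_stage_smem zn tz) xt.
exact: in_stage_smem (in_stage_smem zn tz') yt'.
Qed.

Lemma in_stage_tuple n z x (ys : seq V) : in_V n z -> is_tuple z x ys ->
  forall y, List.In y (x :: ys) -> in_V n y.
Proof.
elim: ys z x => [|y' ys IH] z x zn /= => [<- y [<-|[]] //|].
case=> p pP zP y; have [xn pn] := in_stage_pair zn zP.
case=> [<- //|]; exact: IH pn pP y.
Qed.
End Superstructure.

Section Interpretation.
Variables (S : Type) (V : superstructure S).

Definition cat_clogic (C : category) : clogic (sem V) :=
  @CLogic (sem V) C (@Hom C) (fun p => forall x, p x) (fun p => exists x, p x)
    (fun a b p => forall f, p f) (fun a b p => exists f, p f)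
    (fun a b => a = b) (fun a b f g => f = g)
    (fun a e => e = idc a) (fun a b c g f h => h = g \oc f).

(** Quantifiers match whenever their bodies agree along [io] and [ih]. Every statement built from a
    [clogic] is then preserved by recursion on its shape, which the tactic [interp] carries out. *)
Record interpretation (K K' : clogic (sem V)) := Interpretation {
  io : cob K' -> cob K;
  ih : forall a b, chom K' a b -> chom K (io a) (io b);
  i_all_ob : forall p q, (forall a, p (io a) <-> q a) ->
    all_ob K p <-> all_ob K' q;
  i_ex_ob : forall p q, (forall a, p (io a) <-> q a) ->
    ex_ob K p <-> ex_ob K' q;
  i_all_hom : forall a b p q, (forall f, p (ih f) <-> q f) ->
    all_hom K (io a) (io b) p <-> all_hom K' a b q;
  i_ex_hom : forall a b p q, (forall f, p (ih f) <-> q f) ->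
    ex_hom K (io a) (io b) p <-> ex_hom K' a b q;
  i_eq_ob : forall a b, eq_ob (io a) (io b) <-> eq_ob a b;
  i_eq_hom : forall a b (f g : chom K' a b), eq_hom (ih f) (ih g) <->
    eq_hom f g;
  i_is_id : forall a (e : chom K' a a), is_id _ _ (ih e) <-> is_id _ _ e;
  i_is_comp : forall a b c (g : chom K' b c) (f : chom K' a b) h,
    is_comp (ih g) (ih f) (ih h) <-> is_comp g f h }.

Arguments i_all_ob [K K'] i [p q] pq : rename.
Arguments i_ex_ob [K K'] i [p q] pq : rename.
Arguments i_all_hom [K K'] i [a b p q] pq : rename.
Arguments i_ex_hom [K K'] i [a b p q] pq : rename.
Arguments i_eq_ob [K K'] i a b : rename.
Arguments i_eq_hom [K K'] i [a b] f g : rename.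
Arguments i_is_id [K K'] i [a] e : rename.
Arguments i_is_comp [K K'] i [a b c] g f h : rename.

Definition op_interpretation (K K' : clogic (sem V))
    (i : interpretation K K') : interpretation (op_clogic K) (op_clogic K') :=
  @Interpretation (op_clogic K) (op_clogic K') (io i)
    (fun a b => @ih _ _ i b a) (@i_all_ob _ _ i) (@i_ex_ob _ _ i)
    (fun a b p q => @i_all_hom _ _ i b a p q)
    (fun a b p q => @i_ex_hom _ _ i b a p q)
    (i_eq_ob i) (fun a b => @i_eq_hom _ _ i b a) (@i_is_id _ _ i)
    (fun a b c g f h => @i_is_comp _ _ i c b a f g h).

Lemma i_and (p p' q q' : Prop) : (p <-> p') -> (q <-> q') ->
  @Fand (sem V) p q <-> @Fand (sem V) p' q'.
Proof. by move=> pp qq; split=> -[/pp ? /qq ?]; split. Qed.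

Lemma i_or (p p' q q' : Prop) : (p <-> p') -> (q <-> q') ->
  @For (sem V) p q <-> @For (sem V) p' q'.
Proof. by move=> pp qq; split=> -[/pp ?|/qq ?]; [left|right|left|right]. Qed.

Lemma i_imp (p p' q q' : Prop) : (p <-> p') -> (q <-> q') ->
  @Fimp (sem V) p q <-> @Fimp (sem V) p' q'.
Proof. by move=> pp qq; split=> h /pp /h /qq. Qed.

Ltac interp i :=
  repeat first
  [ apply: i_and | apply: i_or | apply: i_imp
  | apply: (i_all_ob i) => ? | apply: (i_ex_ob i) => ?
  | apply: (i_all_hom i) => ? | apply: (i_ex_hom i) => ?
  | apply: (i_eq_ob i) | apply: (i_eq_hom i) | apply: (i_is_id i)
  | apply: (i_is_comp i) ].

Lemma i_limits K K' (i : interpretation K K') : f_limits K <-> f_limits K'.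
Proof. rewrite /f_limits /f_terminal /f_products /f_equalizers; interp i. Qed.

Lemma i_model K K' (i : interpretation K K') (W F C : clclass K) (W' F' C' :
  clclass K') :
  (forall a b (f : chom K' a b), W _ _ (ih i f) <-> W' _ _ f) ->
  (forall a b (f : chom K' a b), F _ _ (ih i f) <-> F' _ _ f) ->
  (forall a b (f : chom K' a b), C _ _ (ih i f) <-> C' _ _ f) ->
  f_model W F C <-> f_model W' F' C'.
Proof.
move=> WW FF CC; rewrite /f_model.
apply: i_and; first exact: i_limits i.
apply: i_and; first exact: (i_limits (op_interpretation i)).
rewrite /f_ids /f_closed /f_two_of_three /f_retract /f_lifting /f_factorization.
interp i => //.
Qed.

Section LocLike.
Variables (K K' L L' : clogic (sem V)).
Variables (i : interpretation K K') (j : interpretation L L').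
Variables (W F C : clclass K) (W' F' C' : clclass K').
Hypothesis WW : forall a b (f : chom K' a b), W (ih i f) <-> W' f.
Hypothesis FF : forall a b (f : chom K' a b), F (ih i f) <-> F' f.
Hypothesis CC : forall a b (f : chom K' a b), C (ih i f) <-> C' f.
Variable g0 : cob K -> cob L -> Prop.
Variable g1 : forall a b x y, chom K a b -> chom L x y -> Prop.
Variable g0' : cob K' -> cob L' -> Prop.
Variable g1' : forall a b x y, chom K' a b -> chom L' x y -> Prop.
Hypothesis gg0 : forall a x, g0 (io i a) (io j x) <-> g0' a x.
Hypothesis gg1 : forall a b x y (f : chom K' a b) (f' : chom L' x y),
  g1 (ih i f) (ih j f') <-> g1' f f'.

Lemma i_loc_like :
  @f_loc_like (sem V) K L W F C g0 g1 <->
    @f_loc_like (sem V) K' L' W' F' C' g0' g1'.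
Proof.
rewrite /f_loc_like /f_ob_inj /f_ob_surj /f_inverts /f_fractions /f_homotopies.
repeat first
 [ exact: gg0 | exact: gg1 | exact: WW | exact: FF | exact: CC
 | progress interp i | progress interp j ].
Qed.
End LocLike.

Lemma f_limits_cat (C : category) :
  f_limits (cat_clogic C) <-> has_basic_limits C.
Proof.
apply: i_and => //; apply: i_and => //.
split=> eqz a b f g; have [e [i [ie eP]]] := eqz a b f g; exists e, i.
  split; first exact: (ie _ erefl).
  move=> x j fg; have [|h [hE hP]] := eP x j; first by move=> d -> .
  by exists h; split=> // k /hP.
split; first by move=> d ->.
move=> x j fg; have [|h [hE hP]] := eP x j; first exact: (fg _ erefl).
by exists h; split=> // k /hP.
Qed.

Lemma f_model_cat (M : category) (W F C : mor_class M) :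
  @f_model (sem V) (cat_clogic M) W F C <-> is_model_category W F C.
Proof.
have limE := f_limits_cat M; have colimE := f_limits_cat (op M).
have idsE K : @f_ids (sem V) (cat_clogic M) K <-> has_ids K.
  by split=> h a; [apply: h|move=> _ ->; apply: h].
have closedE K : @f_closed (sem V) (cat_clogic M) K <-> comp_closed K.
  split=> h a b c g f; first by move=> Kg Kf; apply: (h _ _ _ g f).
  by move=> _ -> Kg Kf; apply: h.
have retractE K : @f_retract (sem V) (cat_clogic M) K <-> retract_closed K.
  split=> h a b c d f g i r j s.
    move=> ri sj gi fr; apply: (h _ _ _ _ f g i r j s _ erefl (esym ri)
      _ erefl (esym sj) _ erefl gi _ erefl fr).
  move=> _ -> ri _ -> sj _ -> gi _ -> fr; exact: (h _ _ _ _ f g i r j s).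
split.
  case=> [/limE lim [/colimE colim [[/idsE Wi [/idsE Fi /idsE Ci]]]]].
  case=> [[/closedE Wc [/closedE Fc /closedE Cc]]] [W23].
  case=> [[/retractE Wr [/retractE Fr /retractE Cr]]] [lift fact].
  split=> //.
  - exact/has_finite_limitsE.
  - exact/has_finite_colimitsE.
  - by move=> a b c f g; apply: W23.
  - move=> a b x y i p f g e Fp Ci' Wip.
    by have [h [-> ->]] := lift a b x y i p f g _ erefl e Fp Ci' Wip; exists h.
  - move=> a b f; have [[x [i [p [? [? [? ?]]]]]] [x' [i' [p' [? [? [? ?]]]]]]]
    := fact a b f.
    by split; [exists x, i, p|exists x', i', p'].
case=> /has_finite_limitsE lim
  /has_finite_colimitsE colim [Wi Fi Ci] [Wc Fc Cc] W23.
case=> Wr Fr Cr lift fact.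
split; first exact/limE.
split; first exact/colimE.
split; first by split; [exact/idsE|split; exact/idsE].
split; first by split; [exact/closedE|split; exact/closedE].
split; first by move=> a b c f g _ ->; apply: W23.
split; first by split; [exact/retractE|split; exact/retractE].
split.
  move=> a b x y i p f g _ -> e Fp Ci' Wip.
  by have [h [<- <-]] := lift a b x y i p f g e Fp Ci' Wip; exists h.
move=> a b f; have [[x [i [p [? ? ? ?]]]] [x' [i' [p' [? ? ? ?]]]]] :=
  fact a b f.
by split; [exists x, i, p|exists x', i', p'].
Qed.

(** The graph of [G] on morphisms relates arrows with unrelated endpoints, as a set of pairs does;
    comparing total arrows recovers the endpoints. *)
Lemma f_loc_like_cat (M L : category) (G : functor M L) (W F C : mor_class M) :
  @f_loc_like (sem V) (cat_clogic M) (cat_clogic L) W F C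
    (fun a x => x = G a) (fun a b x y f f' => arr f' = arr (fmap G f))
  <-> loc_like W F C G.
Proof.
have projE a : @f_projective (sem V) (cat_clogic M) W F a <->
  projective_ob W F a by [].
have injE a : @f_injective (sem V) (cat_clogic M) W C a <->
  injective_ob W C a by [].
have htpyE a b (f g : Hom a b) :
    @f_left_homotopic (sem V) (cat_clogic M) W a b f g <-> left_homotopic W f g.
  split=> -[c [i0 [i1 [s [H]]]]].
    by case=> [Ws [/(_ _ erefl)[e0 e1] [e2 e3]]]; exists c, i0, i1, s, H.
  by case=> Ws e0 e1 e2 e3; exists c, i0, i1, s, H; split=> //; split=> // _ ->.
split.
  case=> [ob_inj [ob_surj [inv [frac htpy]]]]; split.
  - by move=> a b e; apply: (ob_inj a b (G a)).
  - by move=> y; have [a ->] := ob_surj y; exists a.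
  - move=> a b s Ws.
    have [t [ts st]] := inv a b s Ws _ erefl _ erefl (fmap G s) erefl.
    by exists t; split; apply/esym; [apply: ts|apply: st].
  - move=> a b m.
    have [x [y [t [s [f [Wt [Ws]]]]]]] := frac a b _ erefl _ erefl m.
    case=> [x' [y' [t' [s' [f' [et [es [ef [n [en ef']]]]]]]]]].
    exists x, y, t, s, f; split=> //.
    have [/esym ex _] := arr_ends et; have [_ /esym ey] := arr_ends es.
    case: x' / ex t' f' n et ef en ef' => t' f' n et ef en ef'.
    case: y' / ey s' f' es ef ef' => s' f' es ef ef'.
    by rewrite -(arr_inj et) -(arr_inj es) -(arr_inj ef) ef' en.
  - move=> a b f g pa ib e; apply/htpyE.
    by apply: (htpy a b f g pa ib _ _ (fmap G f) erefl); rewrite e.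
case=> ob_inj ob_surj inv frac htpy.
split; first by move=> a b y -> /ob_inj.
split; first by move=> y; have [a <-] := ob_surj y; exists a.
split.
  move=> a b s Ws a' -> b' -> s' /arr_inj ->.
  by have [t [ts st]] := inv a b s Ws; exists t; split=> _ ->.
split.
  move=> a b a' -> b' -> m.
  have [x [y [t [s [f [Wt Ws e]]]]]] := frac a b m.
  exists x, y, t, s, f; split=> //; split=> //.
  exists (G x), (G y), (fmap G t), (fmap G s), (fmap G f).
  by do 3!split=> //; exists (m \oc fmap G t).
move=> a b f g pa ib a' b' h ef eg; apply/htpyE; apply: htpy => //.
by apply: arr_inj; rewrite -ef -eg.
Qed.
End Interpretation.

(** * Coded categories and functors *)

Lemma sval_inj (T : Type) (P : T -> Prop) (x y : {x : T | P x}) :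
  sval x = sval y -> x = y.
Proof. by case: x y => x Px [y Py] /= e; apply: eq_exist. Qed.

Definition code_of (S : Type) (V : superstructure S) (c : category_code V) :
  code V :=
  Code (c_obj c) (c_mor c) (c_src c) (c_tgt c) (c_id c) (c_comp c).

Section Coding.
Variables (S : Type) (V : superstructure S) (u eps : V).
Local Notation I := (individuals V).
Hypothesis eps_I : forall x y, related eps x y -> smem x I.

Section Code.
Variable c : category_code V.
Local Notation K := (@code_clogic (sem V) eps I (code_of c)).

Definition obj (x : V) : Prop := related eps x (c_obj c).
Definition hom (f x y : V) : Prop :=
  related eps f (c_mor c) /\ related (c_src c) f x /\ related (c_tgt c) f y.
Definition cmp (g f h : V) : Prop :=
  exists2 z, smem z (c_comp c) & is_tuple z g [:: f; h].

Lemma f_homE f x y : @f_hom (sem V) eps (code_of c) f x y <-> hom f x y.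
Proof. by split=> -[/f_relatedE ? [/f_relatedE ? /f_relatedE ?]]. Qed.

(** By [eps_I] all objects and morphisms are individuals, so the bound [I] loses nothing, here and
    in the next three lemmas. *)
Lemma all_obE (p : V -> Prop) : all_ob K p <-> (forall x, obj x -> p x).
Proof.
split=> h x; first by move=> ox; apply: h (eps_I ox) _; apply/f_relatedE.
by move=> _ /f_relatedE; apply: h.
Qed.

Lemma ex_obE (p : V -> Prop) : ex_ob K p <-> (exists2 x, obj x & p x).
Proof.
split=> [[x _ [/f_relatedE ox px]]|[x ox px]]; first by exists x.
by exists x; [apply: eps_I ox|split=> //; apply/f_relatedE].
Qed.

Lemma all_homE x y (p : V -> Prop) :
  all_hom K x y p <-> (forall f, hom f x y -> p f).
Proof.
split=> h f; first by move=> [fm fxy]; apply: h (eps_I fm) _; apply/f_homE.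
by move=> _ /f_homE; apply: h.
Qed.

Lemma ex_homE x y (p : V -> Prop) :
  ex_hom K x y p <-> (exists2 f, hom f x y & p f).
Proof.
split=> [[f _ [/f_homE fxy pf]]|[f fxy pf]]; first by exists f.
by exists f; [case: fxy => /eps_I|split=> //; apply/f_homE].
Qed.

Lemma is_idE x f : is_id K x f <-> related (c_id c) x f.
Proof. exact: f_relatedE. Qed.

Lemma is_compE x y z g f h : @is_comp _ K x y z g f h <-> cmp g f h.
Proof. by split=> -[t tk /f_tupleE tP]; exists t. Qed.

Section Decoding.
Hypothesis cP : @f_category (sem V) u eps I (code_of c).

Lemma hom_of_mor f : related eps f (c_mor c) ->
  exists x y, [/\ obj x, obj y, hom f x y &
    forall x' y', obj x' -> obj y' -> hom f x' y' -> x' = x /\ y' = y].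
Proof.
move: cP => [_ [_ [_ [_ [_ [_ [/(_ f) h _]]]]]]] fm.
have {}h := h (eps_I fm) ((f_relatedE _ _ _).2 fm).
case/ex_obE: h => x ox /ex_obE[y oy [/f_homE fxy uniq]].
exists x, y; split=> // x' y' ox' oy' /f_homE f'.
by move/all_obE: uniq => /(_ _ ox')/all_obE/(_ _ oy'); apply.
Qed.

Lemma src_hom z : smem z (c_src c) -> exists x y f,
  [/\ obj x, obj y, hom f x y & is_pair z f x].
Proof.
move: cP => [_ [_ [h _]]] /h/ex_obE[x ox /ex_obE[y oy /ex_homE[f fxy
  /f_pairE]]].
by exists x, y, f.
Qed.

Lemma tgt_hom z : smem z (c_tgt c) -> exists x y f,
  [/\ obj x, obj y, hom f x y & is_pair z f y].
Proof.
move: cP => [_ [_ [_ [h _]]]] /h/ex_obE[x ox /ex_obE[y oy /ex_homE[f fxy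
  /f_pairE]]].
by exists x, y, f.
Qed.

Lemma id_hom z : smem z (c_id c) -> exists x f,
  [/\ obj x, hom f x x & is_pair z x f].
Proof.
move: cP => [_ [_ [_ [_ [h _]]]]] /h/ex_obE[x ox /ex_homE[f fxx /f_pairE]].
by exists x, f.
Qed.

Lemma comp_hom z : smem z (c_comp c) -> exists x y w g f h,
  [/\ [/\ obj x, obj y & obj w], hom g y w, hom f x y, hom h x w
    & is_tuple z g [:: f; h]].
Proof.
move: cP => [_ [_ [_ [_ [_ [h _]]]]]] /h/ex_obE[x ox /ex_obE[y oy
  /ex_obE[w ow]]].
case/ex_homE=> g gyw /ex_homE[f fxy /ex_homE[l lxw /f_tupleE zP]].
by exists x, y, w, g, f, l.
Qed.

Lemma id_total x : obj x -> {e : V | [/\ hom e x x, related (c_id c) x e,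
  forall e', hom e' x x -> related (c_id c) x e' -> e' = e,
  forall y f, obj y -> hom f x y -> cmp f e f &
  forall y f, obj y -> hom f y x -> cmp e f f]}.
Proof.
move=> ox; apply: cid; move: cP => [_ [_ [_ [_ [_ [_ [_ [h _]]]]]]]].
move/all_obE: h => /(_ _ ox)/ex_homE[e exx [/f_relatedE xe [uniq [h1 h2]]]].
exists e; split=> // [e' e'xx /f_relatedE xe'|y f oy fxy|y f oy fyx].
- by move/all_homE: uniq; apply=> //; apply/f_relatedE.
- by move/all_obE: h1 => /(_ _ oy)/all_homE/(_ _ fxy)/is_compE.
- by move/all_obE: h2 => /(_ _ oy)/all_homE/(_ _ fyx)/is_compE.
Qed.

Lemma comp_total x y w g f : obj x -> obj y -> obj w -> hom g y w ->
  hom f x y -> {h : V | [/\ hom h x w, cmp g f h &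
    forall h', hom h' x w -> cmp g f h' -> h' = h]}.
Proof.
move=> ox oy ow gyw fxy; apply: cid.
move: cP => [_ [_ [_ [_ [_ [_ [_ [_ [h _]]]]]]]]].
move/all_obE: h => /(_ _ ox)/all_obE/(_ _ oy)/all_obE/(_ _ ow).
move/all_homE=> /(_ _ gyw)/all_homE/(_ _ fxy)/ex_homE[h hxw [/is_compE hc
  uniq]].
exists h; split=> // h' h'xw hc'.
by move/all_homE: uniq; apply=> //; apply/is_compE.
Qed.

Lemma comp_assoc x y w v h g f gf hg l :
  [/\ obj x, obj y, obj w & obj v] ->
  hom h w v -> hom g y w -> hom f x y ->
  hom gf x w -> hom hg y v -> hom l x v ->
  cmp g f gf -> cmp h g hg -> cmp h gf l -> cmp hg f l.
Proof.
case=> ox oy ow ov hh hg_ hf hgf hhg hl.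
move: cP => [_ [_ [_ [_ [_ [_ [_ [_ [_ ass]]]]]]]]].
move/all_obE: ass =>
  /(_ _ ox)/all_obE/(_ _ oy)/all_obE/(_ _ ow)/all_obE/(_ _ ov).
move/all_homE=> /(_ _ hh)/all_homE/(_ _ hg_)/all_homE/(_ _ hf).
move/all_homE=> /(_ _ hgf)/all_homE/(_ _ hhg)/all_homE/(_ _ hl) ass.
move=> c1 c2 c3; have cE x' y' z' g' f' h' := @is_compE x' y' z' g' f' h'.
exact: (cE x y v hg f l).1 (ass ((cE x y w g f gf).2 c1)
  ((cE y w v h g hg).2 c2) ((cE x w v h gf l).2 c3)).
Qed.

(** A code that satisfies [f_category] is turned into an actual category: homs are subtypes of [V],
    and identities and composites are extracted from the graphs by unique existence. *)
Definition dOb := {x : V | obj x}.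
Definition dHom (x y : dOb) := {f : V | hom f (sval x) (sval y)}.

Definition did (x : dOb) : dHom x x :=
  let e := id_total (svalP x) in
  exist _ (sval e) (let: And5 h _ _ _ _ := svalP e in h).

Definition dcomp (x y w : dOb) (g : dHom y w) (f : dHom x y) : dHom x w :=
  let h := comp_total (svalP x) (svalP y) (svalP w) (svalP g) (svalP f) in
  exist _ (sval h) (let: And3 h' _ _ := svalP h in h').

Lemma dcompP (x y w : dOb) (g : dHom y w) (f : dHom x y) (h : dHom x w) :
  cmp (sval g) (sval f) (sval h) <-> h = dcomp g f.
Proof.
rewrite /dcomp; case: comp_total => k /= [kxw kc uniq]; split=> [hc|-> //].
by apply: sval_inj; apply: uniq => //; apply: (svalP h).
Qed.

Lemma dcompA (x y w v : dOb) (h : dHom w v) (g : dHom y w) (f : dHom x y) :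
  dcomp h (dcomp g f) = dcomp (dcomp h g) f.
Proof.
apply/dcompP; apply: (comp_assoc _ (svalP h) (svalP g) (svalP f)
  (svalP (dcomp g f)) (svalP (dcomp h g)) (svalP (dcomp h (dcomp g f))));
  try by apply/dcompP.
by split; apply: svalP.
Qed.

Lemma dcomp1c (x y : dOb) (f : dHom x y) : dcomp (did y) f = f.
Proof.
apply/esym/dcompP; rewrite /did; case: id_total => e /= [_ _ _ _ h].
exact: h (svalP x) (svalP f).
Qed.

Lemma dcompc1 (x y : dOb) (f : dHom x y) : dcomp f (did x) = f.
Proof.
apply/esym/dcompP; rewrite /did; case: id_total => e /= [_ _ _ h _].
exact: h (svalP y) (svalP f).
Qed.

Definition decoded : category := Category dcompA dcomp1c dcompc1.

Definition drob (a : decoded) : V := sval a.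
Definition drmor (a b : decoded) (f : Hom a b) : V := sval (f : dHom a b).

Lemma decoded_reads : reads u eps c decoded.
Proof.
have [[ou au] [[s_set [t_set [i_set k_set]]] _]] := cP.
have rel_pair (r x y : V) z : related r x y -> is_pair z x y -> smem z r.
  by case=> z' z'r zP' zP; rewrite (pair_uniq zP zP').
apply: (@Reads _ _ _ _ _ _ drob drmor).
- by move=> a b; apply: sval_inj.
- move=> a b a' b' f f' e.
  have [x [y [ox oy fxy uniq]]] := hom_of_mor (svalP f).1.
  have [ea eb] := uniq _ _ (svalP a) (svalP b) (svalP f).
  have f'P : hom (sval f) (sval a') (sval b').
    by rewrite -[sval f]/(drmor f) e; apply: (svalP f').
  have [ea' eb'] := uniq _ _ (svalP a') (svalP b') f'P.
  by split; apply: sval_inj; rewrite ?ea ?eb.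
- by move=> a b f g; apply: sval_inj.
- by [].
- by split; apply/is_setE.
- move=> x; split=> [ox|[a ->]]; last exact: (svalP a).
  by exists (exist _ x ox).
- move=> f; split=> [fm|[a [b [f' ->]]]]; last by case: (svalP f').
  have [x [y [ox oy fxy _]]] := hom_of_mor fm.
  by exists (exist _ x ox), (exist _ y oy), (exist _ f fxy).
- move=> z; split=> [/src_hom[x [y [f [ox oy fxy zP]]]]|[a [b [f zP]]]].
    by exists (exist _ x ox), (exist _ y oy), (exist _ f fxy).
  by apply: rel_pair zP; case: (svalP f) => _ [].
- move=> z; split=> [/tgt_hom[x [y [f [ox oy fxy zP]]]]|[a [b [f zP]]]].
    by exists (exist _ x ox), (exist _ y oy), (exist _ f fxy).
  by apply: rel_pair zP; case: (svalP f) => _ [].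
- move=> z; split=> [zi|[a zP]].
    have [x [f [ox fxx zP]]] := id_hom zi; exists (exist _ x ox).
    rewrite /drob /drmor /=; case: id_total => e /= [exx _ uniq _ _].
    by rewrite -(uniq f) //; exists z.
  apply: rel_pair zP; rewrite /drob /drmor /=.
  by case: id_total => e /= [].
- move=> z; split=> [zk|[a [b [d [g [f zP]]]]]].
    have [x [y [w [g [f [h [[ox oy ow] gyw fxy hxw zP]]]]]]] := comp_hom zk.
    exists (exist _ x ox), (exist _ y oy), (exist _ w ow), (exist _ g gyw),
      (exist _ f fxy).
    rewrite /drmor /=; case: comp_total => k /= [kxw kc uniq].
    by rewrite -(uniq h) //; exists z.
  have [z' z'k zP'] : cmp (drmor g) (drmor f) (drmor (g \oc f)) by apply/dcompP.
  by rewrite (tuple_uniq zP zP').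
Qed.
End Decoding.

Section Encoding.
Variables (C : category) (r : reads u eps c C).

Lemma reads_hom (a b : C) (f : Hom a b) : hom (rmor r f) (rob r a) (rob r b).
Proof.
split; first by apply/(reads_mor r); exists a, b, f.
have [z zP] := pair_exists (rmor r f) (rob r a).
have [z' zP'] := pair_exists (rmor r f) (rob r b).
by split; [exists z => //; apply/(reads_src r)|exists z' => //;
  apply/(reads_tgt r)];
  exists a, b, f.
Qed.

Lemma reads_ob (a : C) : obj (rob r a).
Proof. by apply/(reads_obj r); exists a. Qed.

Lemma reads_homP f x y : hom f x y ->
  exists (a b : C) (f' : Hom a b), [/\ f = rmor r f', x = rob r a &
    y = rob r b].
Proof.
case=> /(reads_mor r)[a [b [f' ef]]] [[z zs zP] [z' zt zP']].
exists a, b, f'; split=> //.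
- move/(reads_src r): zs => [a1 [b1 [f1 zP1]]].
  have [e ->] := pair_inj zP zP1; rewrite ef in e.
  by have [->] := rmor_ends e.
- move/(reads_tgt r): zt => [a1 [b1 [f1 zP1]]].
  have [e ->] := pair_inj zP' zP1; rewrite ef in e.
  by have [_ ->] := rmor_ends e.
Qed.

Lemma rmor_arr (a b a' b' : C) (f : Hom a b) (f' : Hom a' b') :
  rmor r f = rmor r f' <-> arr f = arr f'.
Proof.
split=> e.
  have [ea eb] := rmor_ends e; case: a' / ea f' e => f'; case: b' / eb f' => f'.
  by move/(@rmor_inj _ _ _ _ _ _ r) ->.
have [ea eb] := arr_ends e; case: a' / ea f' e => f'; case: b' / eb f' => f'.
by move/arr_inj ->.
Qed.

Lemma reads_hom_ex (a b : C) f : hom f (rob r a) (rob r b) ->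
  exists f' : Hom a b, f = rmor r f'.
Proof.
case/reads_homP => a' [b' [f' [-> /(@rob_inj _ _ _ _ _ _ r) ea
  /(@rob_inj _ _ _ _ _ _ r) eb]]].
by case: a' / ea f' => f'; case: b' / eb f' => f'; exists f'.
Qed.

Lemma reads_id_ex x f : related (c_id c) x f <->
  exists a : C, x = rob r a /\ f = rmor r (idc a).
Proof.
split=> [[z /(reads_id r)[a zP] zP']|[a [-> ->]]].
  by have [-> ->] := pair_inj zP' zP; exists a.
have [z zP] := pair_exists (rob r a) (rmor r (idc a)).
by exists z => //; apply/(reads_id r); exists a.
Qed.

Lemma reads_idE (a : C) (e : Hom a a) :
  related (c_id c) (rob r a) (rmor r e) <-> e = idc a.
Proof.
split=> [/reads_id_ex[a' [/(@rob_inj _ _ _ _ _ _ r) <-]]|->].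
  exact: rmor_inj.
by apply/reads_id_ex; exists a.
Qed.

Lemma reads_compE (a b d : C) (g : Hom b d) (f : Hom a b) (h : Hom a d) :
  cmp (rmor r g) (rmor r f) (rmor r h) <-> h = g \oc f.
Proof.
split=> [[z /(reads_comp r)[a' [b' [d' [g' [f' zP]]]]] zP']|->].
  case: (@tuple_inj _ _ z _ _ [:: _; _] [:: _;
    _] (erefl 2) zP' zP) => /rmor_arr eg /rmor_arr ef /rmor_arr eh.
  by apply: arr_inj; rewrite eh; apply/esym/arr_comp.
have [z zP] := tuple_exists (rmor r g) [:: rmor r f; rmor r (g \oc f)].
by exists z => //; apply/(reads_comp r); exists a, b, d, g, f.
Qed.

Lemma reads_all_ob (p : V -> Prop) : (forall a, p (rob r a)) -> all_ob K p.
Proof. by move=> h; apply/all_obE => x /(reads_obj r)[a ->]. Qed.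

Lemma reads_ex_ob (p : V -> Prop) a : p (rob r a) -> ex_ob K p.
Proof. by move=> h; apply/ex_obE; exists (rob r a) => //; apply: reads_ob. Qed.

Lemma reads_all_hom (p : V -> Prop) a b :
  (forall f : Hom a b, p (rmor r f)) -> all_hom K (rob r a) (rob r b) p.
Proof. by move=> h; apply/all_homE => f /reads_hom_ex[f' ->]. Qed.

Lemma reads_ex_hom (p : V -> Prop) a b (f : Hom a b) :
  p (rmor r f) -> ex_hom K (rob r a) (rob r b) p.
Proof. by move=> h; apply/ex_homE; exists (rmor r f) => //;
  apply: reads_hom. Qed.

Lemma reads_interpretation : interpretation K (cat_clogic V C).
Proof.
apply: (@Interpretation _ _ K (cat_clogic V C) (rob r) (@rmor _ _ _ _ _ _ r)).
- move=> p q pq; rewrite all_obE; split=> [h a|h x /(reads_obj r)[a ->]].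
    by apply/pq/h/reads_ob.
  by apply/pq/h.
- move=> p q pq; rewrite ex_obE; split=> [[x /(reads_obj r)[a ->] /pq]|[a /pq]].
    by exists a.
  by exists (rob r a) => //; apply: reads_ob.
- move=> a b p q pq; rewrite all_homE; split=> [h f|h f /reads_hom_ex[f' ->]].
    by apply/pq/h/reads_hom.
  by apply/pq/h.
- move=> a b p q pq; rewrite ex_homE;
  split=> [[f /reads_hom_ex[f' ->] /pq]|[f /pq]].
    by exists f'.
  by exists (rmor r f) => //; apply: reads_hom.
- by move=> a b; split=> [|->] //; apply: rob_inj.
- by move=> a b f g; split=> [|->] //; apply: rmor_inj.
- by move=> a e; rewrite is_idE reads_idE.
- by move=> a b d g f h; rewrite is_compE reads_compE.
(* Transparent, so that [io] and [ih] compute to [rob] and [rmor] when classes and graphs are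
   compared later. *)
Defined.
End Encoding.
End Code.
End Coding.

Section Encoding.
Variables (S : Type) (V : superstructure S) (u eps : V).
Local Notation I := (individuals V).
Hypothesis eps_I : forall x y, related eps x y -> smem x I.
Local Notation logic_of c := (@code_clogic (sem V) eps I (code_of c)).

Lemma reads_category (c : category_code V) (C : category) :
  reads u eps c C -> @f_category (sem V) u eps I (code_of c).
Proof.
move=> r; have [ou au] := reads_small r.
have [s_set t_set i_set k_set] := reads_sets r.
have all_ob_ := @reads_all_ob _ _ _ _ eps_I _ _ r;
  have ex_ob_ := @reads_ex_ob _ _ _ _ eps_I _ _ r.
have all_hom_ := @reads_all_hom _ _ _ _ eps_I _ _ r;
  have ex_hom_ := @reads_ex_hom _ _ _ _ eps_I _ _ r.
have compE := reads_compE r.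
have is_compE x y z g f h := @is_compE _ _ eps c x y z g f h.
split; first by [].
split; first by do !split; apply/is_setE.
split.
  move=> z /(reads_src r)[a [b [f zP]]].
  by apply: (ex_ob_ _ a); apply: (ex_ob_ _ b); apply: (ex_hom_ _ _ _ f);
    apply/f_pairE.
split.
  move=> z /(reads_tgt r)[a [b [f zP]]].
  by apply: (ex_ob_ _ a); apply: (ex_ob_ _ b); apply: (ex_hom_ _ _ _ f);
    apply/f_pairE.
split.
  move=> z /(reads_id r)[a zP].
  by apply: (ex_ob_ _ a); apply: (ex_hom_ _ _ _ (idc a)); apply/f_pairE.
split.
  move=> z /(reads_comp r)[a [b [d [g [f zP]]]]].
  apply: (ex_ob_ _ a); apply: (ex_ob_ _ b); apply: (ex_ob_ _ d).
  apply: (ex_hom_ _ _ _ g); apply: (ex_hom_ _ _ _ f).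
  by apply: (ex_hom_ _ _ _ (g \oc f)); apply/f_tupleE.
split.
  move=> f _ /f_relatedE/(reads_mor r)[a [b [f' ->]]].
  apply: (ex_ob_ _ a); apply: (ex_ob_ _ b).
  split; first by apply/f_homE/reads_hom.
  apply/(all_obE eps_I) => x _;
    apply/(all_obE eps_I) => y _ /f_homE/(reads_homP r).
  by case=> a' [b' [f'' [/rmor_ends[-> ->] -> ->]]].
split.
  apply: (all_ob_ _) => a; apply: (ex_hom_ _ _ _ (idc a)).
  split; first by apply/f_relatedE/(reads_idE r).
  split; first by apply: (all_hom_ _ _ _) => e /f_relatedE/(reads_idE r) ->.
  split.
    apply: (all_ob_ _) => b; apply: (all_hom_ _ _ _) => f.
    by apply/is_compE/compE; rewrite compc1.
  apply: (all_ob_ _) => b; apply: (all_hom_ _ _ _) => f.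
  by apply/is_compE/compE; rewrite comp1c.
split.
  apply: (all_ob_ _) => a; apply: (all_ob_ _) => b; apply: (all_ob_ _) => d.
  apply: (all_hom_ _ _ _) => g; apply: (all_hom_ _ _ _) => f.
  apply: (ex_hom_ _ _ _ (g \oc f)); split; first by apply/is_compE/compE.
  by apply: (all_hom_ _ _ _) => h /is_compE/compE ->.
apply: (all_ob_ _) => a; apply: (all_ob_ _) => b; apply: (all_ob_ _) => d;
  apply: (all_ob_ _) => e.
apply: (all_hom_ _ _ _) => h; apply: (all_hom_ _ _ _) => g;
  apply: (all_hom_ _ _ _) => f.
apply: (all_hom_ _ _ _) => gf; apply: (all_hom_ _ _ _) => hg;
  apply: (all_hom_ _ _ _) => l.
move=> /is_compE/compE -> /is_compE/compE -> /is_compE/compE ->.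
by apply/is_compE/compE; rewrite compA.
Qed.

Section Functors.
Variables (c d : category_code V) (C D : category).
Variables (r : reads u eps c C) (r' : reads u eps d D).
Variables g0 g1 : V.

Definition reads_graphs (G : functor C D) : Prop :=
  (is_set g0 /\
    forall z, smem z g0 <-> exists a : C, is_pair z (rob r a) (rob r' (G a))) /\
  (is_set g1 /\
    forall z, smem z g1 <-> exists (a b : C) (f : Hom a b),
      is_pair z (rmor r f) (rmor r' (fmap G f))).

Lemma reads_graph0 (G : functor C D) a x : reads_graphs G ->
  related g0 (rob r a) x <-> x = rob r' (G a).
Proof.
case=> [[_ g0P] _]; split=> [[z /g0P[b zP] zP']|->].
  by have [/(@rob_inj _ _ _ _ _ _ r) -> ->] := pair_inj zP' zP.
have [z zP] := pair_exists (rob r a) (rob r' (G a)).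
by exists z => //; apply/g0P; exists a.
Qed.

Lemma reads_graph1 (G : functor C D) (a b : C) (f : Hom a b) x :
  reads_graphs G -> related g1 (rmor r f) x <-> x = rmor r' (fmap G f).
Proof.
case=> [_ [_ g1P]]; split=> [[z /g1P[a' [b' [f' zP]]] zP']|->].
  have [/rmor_arr e ->] := pair_inj zP' zP.
  by apply/rmor_arr/arr_fmap.
have [z zP] := pair_exists (rmor r f) (rmor r' (fmap G f)).
by exists z => //; apply/g1P; exists a, b, f.
Qed.

Lemma reads_graphs_functor (G : functor C D) : reads_graphs G ->
  @f_functor (sem V) eps I (code_of c) (code_of d) g0 g1.
Proof.
move=> gP; have [[g0s g0P] [g1s g1P]] := gP.
have all_ob_ := @reads_all_ob _ _ _ _ eps_I _ _ r;
  have ex_ob_ := @reads_ex_ob _ _ _ _ eps_I _ _ r.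
have all_hom_ := @reads_all_hom _ _ _ _ eps_I _ _ r;
  have ex_hom_ := @reads_ex_hom _ _ _ _ eps_I _ _ r.
have all_ob' := @reads_all_ob _ _ _ _ eps_I _ _ r';
  have ex_ob' := @reads_ex_ob _ _ _ _ eps_I _ _ r'.
have all_hom' := @reads_all_hom _ _ _ _ eps_I _ _ r';
  have ex_hom' := @reads_ex_hom _ _ _ _ eps_I _ _ r'.
have g0E a x : @f_related (sem V) g0 (rob r a) x <-> x = rob r' (G a).
  by rewrite f_relatedE; apply: reads_graph0.
have g1E a b (f : Hom a b) x : @f_related (sem V) g1 (rmor r f) x <->
  x = rmor r' (fmap G f).
  by rewrite f_relatedE; apply: reads_graph1.
split; first by split; apply/is_setE.
split.
  move=> z /g0P[a zP].
  by apply: (ex_ob_ _ a); apply: (ex_ob' _ (G a)); apply/f_pairE.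
split.
  move=> z /g1P[a [b [f zP]]].
  apply: (ex_ob_ _ a); apply: (ex_ob_ _ b); apply: (ex_hom_ _ _ _ f).
  apply: (ex_ob' _ (G a)); apply: (ex_ob' _ (G b));
    apply: (ex_hom' _ _ _ (fmap G f)).
  by split; [apply/g0E|split; [apply/g0E|apply/f_pairE]].
split.
  apply: (all_ob_ _) => a; apply: (ex_ob' _ (G a)); split; first exact/g0E.
  by apply: (all_ob' _) => x /g0E.
split.
  apply: (all_ob_ _) => a; apply: (all_ob_ _) => b;
    apply: (all_hom_ _ _ _) => f.
  apply: (all_ob' _) => x /g0E ->; apply: (all_ob' _) => y /g0E ->.
  apply: (ex_hom' _ _ _ (fmap G f)); split; first exact/g1E.
  by apply: (all_hom' _ _ _) => f' /g1E.
split.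
  apply: (all_ob_ _) => a;
    apply: (all_hom_ _ _ _) => e /f_relatedE/(reads_idE r) ->.
  apply: (all_ob' _) => x /g0E ->; apply: (all_hom' _ _ _) => e' /g1E ->.
  by rewrite fmap1; apply/f_relatedE/(reads_idE r').
apply: (all_ob_ _) => a; apply: (all_ob_ _) => b; apply: (all_ob_ _) => x.
apply: (all_hom_ _ _ _) => g; apply: (all_hom_ _ _ _) => f;
  apply: (all_hom_ _ _ _) => h.
move=> /(@is_compE _ _ eps c)/(reads_compE r) ->.
apply: (all_ob' _) => a' /g0E ->; apply: (all_ob' _) => b' /g0E ->;
  apply: (all_ob' _) => x' /g0E ->.
apply: (all_hom' _ _ _) => g' /g1E ->; apply: (all_hom' _ _ _) => f' /g1E ->;
  apply: (all_hom' _ _ _) => h' /g1E ->.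
by apply/(@is_compE _ _ eps d)/(reads_compE r'); rewrite fmapM.
Qed.

(** The graphs are total and single-valued, so the two maps are chosen from them, and the uniqueness
    parts exclude further entries. *)
Lemma functor_reads_graphs :
  @f_functor (sem V) eps I (code_of c) (code_of d) g0 g1 ->
  exists G : functor C D, reads_graphs G.
Proof.
case=> [[g0s g1s] [g0P [g1P [tot0 [tot1 [idP compP]]]]]].
have {}tot0 a : {x : D | related g0 (rob r a) (rob r' x) /\
    forall y, related g0 (rob r a) (rob r' y) -> y = x}.
  apply: cid; move/(all_obE eps_I): tot0 => /(_ _ (reads_ob r a)).
  case/(ex_obE eps_I) => x /(reads_obj r')[b ->] [/f_relatedE ab uniq].
  exists b; split=> // y /f_relatedE ay; apply: (rob_inj (r := r')).
  by move/(all_obE eps_I): uniq => /(_ _ (reads_ob r' y)); apply.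
pose G0 a := sval (tot0 a).
have G0P a : related g0 (rob r a) (rob r' (G0 a)) by case: (svalP (tot0 a)).
have G0E a y : related g0 (rob r a) (rob r' y) ->
  y = G0 a by case: (svalP (tot0 a)) => _; apply.
have {}tot1 a b (f : Hom a b) : {h : Hom (G0 a) (G0 b) |
    related g1 (rmor r f) (rmor r' h) /\
    forall k : Hom (G0 a) (G0 b), related g1 (rmor r f) (rmor r' k) -> k = h}.
  apply: cid; move/(all_obE eps_I): tot1 => /(_ _ (reads_ob r a)).
  move/(all_obE eps_I) => /(_ _ (reads_ob r b)).
  move/(all_homE eps_I) => /(_ _ (reads_hom r f)).
  move/(all_obE eps_I) =>
    /(_ _ (reads_ob r' (G0 a)) ((f_relatedE _ _ _).2 (G0P a))).
  move/(all_obE eps_I) =>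
    /(_ _ (reads_ob r' (G0 b)) ((f_relatedE _ _ _).2 (G0P b))).
  case/(ex_homE eps_I) => h /(reads_hom_ex)[h' ->] [/f_relatedE fh uniq].
  exists h'; split=> // k /f_relatedE fk; apply: (rmor_inj (r := r')).
  by move/(all_homE eps_I): uniq => /(_ _ (reads_hom r' k)); apply.
pose G1 a b (f : Hom a b) := sval (tot1 a b f).
have G1P a b (f : Hom a b) : related g1 (rmor r f) (rmor r' (G1 _ _ f)).
  by case: (svalP (tot1 a b f)).
have G1E a b (f : Hom a b) k : related g1 (rmor r f) (rmor r' k) ->
  k = G1 _ _ f.
  by case: (svalP (tot1 a b f)) => _; apply.
have G1id a : G1 _ _ (idc a) = idc (G0 a).
  apply/(reads_idE r')/f_relatedE.
  move/(all_obE eps_I): idP => /(_ _ (reads_ob r a)).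
  move/(all_homE eps_I) => /(_ _ (reads_hom r (idc a))) h.
  have {}h := h ((f_relatedE _ _ _).2 ((reads_idE r (idc a)).2 erefl)).
  move/(all_obE eps_I): h =>
    /(_ _ (reads_ob r' (G0 a)) ((f_relatedE _ _ _).2 (G0P a))).
  move/(all_homE eps_I) => /(_ _ (reads_hom r' (G1 _ _ (idc a)))); apply.
  exact/f_relatedE.
have G1M a b x (g : Hom b x) (f : Hom a b) :
    G1 _ _ (g \oc f) = G1 _ _ g \oc G1 _ _ f.
  apply/(reads_compE r').
  move/(all_obE eps_I): compP => /(_ _ (reads_ob r a)).
  move/(all_obE eps_I) => /(_ _ (reads_ob r b)).
  move/(all_obE eps_I) => /(_ _ (reads_ob r x)).
  move/(all_homE eps_I) => /(_ _ (reads_hom r g)).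
  move/(all_homE eps_I) => /(_ _ (reads_hom r f)).
  move/(all_homE eps_I) => /(_ _ (reads_hom r (g \oc f))) h.
  have {}h := h ((@is_compE _ _ eps c (rob r a) (rob r b) (rob r x) _ _ _).2
    ((reads_compE r g f _).2 erefl)).
  move/(all_obE eps_I): h =>
    /(_ _ (reads_ob r' (G0 a)) ((f_relatedE _ _ _).2 (G0P a))).
  move/(all_obE eps_I) =>
    /(_ _ (reads_ob r' (G0 b)) ((f_relatedE _ _ _).2 (G0P b))).
  move/(all_obE eps_I) =>
    /(_ _ (reads_ob r' (G0 x)) ((f_relatedE _ _ _).2 (G0P x))).
  move/(all_homE eps_I) =>
    /(_ _ (reads_hom r' (G1 _ _ g)) ((f_relatedE _ _ _).2 (G1P _ _ g))).
  move/(all_homE eps_I) =>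
    /(_ _ (reads_hom r' (G1 _ _ f)) ((f_relatedE _ _ _).2 (G1P _ _ f))).
  move/(all_homE eps_I) =>
    /(_ _ (reads_hom r' (G1 _ _ (g \oc f))) ((f_relatedE _ _ _).2 (G1P _ _ (g
      \oc f)))).
  by move/is_compE.
exists (@Functor C D G0 G1 G1id G1M); split; split; try exact/is_setE.
- move=> z; split=> [zg|[a zP]]; last first.
    by have [z' z'g zP'] := G0P a; rewrite (pair_uniq zP zP').
  case/(ex_obE eps_I): (g0P z zg) => x /(reads_obj r)[a ->].
  case/(ex_obE eps_I) => y /(reads_obj r')[b ->] /f_pairE zP.
  by exists a; rewrite /= -(G0E a b) //; exists z.
- move=> z; split=> [zg|[a [b [f zP]]]]; last first.
    by have [z' z'g zP'] := G1P _ _ f; rewrite (pair_uniq zP zP').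
  case/(ex_obE eps_I): (g1P z zg) => x /(reads_obj r)[a ->].
  case/(ex_obE eps_I) => y /(reads_obj r)[b ->].
  case/(ex_homE eps_I) => f /(reads_hom_ex)[f' ->].
  case/(ex_obE eps_I) => x' /(reads_obj r')[a' ->].
  case/(ex_obE eps_I) => y' /(reads_obj r')[b' ->].
  case/(ex_homE eps_I) => h /(reads_hom_ex)[h' ->].
  case=> /f_relatedE/G0E/esym ea [/f_relatedE/G0E/esym eb /f_pairE zP].
  exists a, b, f'; rewrite /=.
  case: a' / ea h' zP => h' zP; case: b' / eb h' zP => h' zP.
  by rewrite -(G1E _ _ f' h') //; exists z.
Qed.
End Functors.

Section Classes.
Variables (c : category_code V) (C : category) (r : reads u eps c C).

Lemma reads_class_mem (w : V) (X : mor_class C) (a b : C) (f : Hom a b) :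
  reads_class r w X -> smem (rmor r f) w <-> X a b f.
Proof.
case=> _ wP; rewrite wP; split=> [[a' [b' [f' [Xf' /rmor_arr e]]]]|Xf];
  last by exists a, b, f.
have [ea eb] := arr_ends e; case: a' / ea f' Xf' e => f' Xf' e.
by case: b' / eb f' Xf' e => f' Xf' /arr_inj ->.
Qed.

Lemma reads_class_f_class (w : V) (X : mor_class C) :
  reads_class r w X -> @f_class (sem V) eps I (code_of c) w.
Proof.
case=> w_set wP; split; first exact/is_setE.
move=> x /wP[a [b [f [_ ->]]]].
apply: (@reads_ex_ob _ _ _ _ eps_I _ _ r _ a);
  apply: (@reads_ex_ob _ _ _ _ eps_I _ _ r _ b).
exact: (@reads_ex_hom _ _ _ _ eps_I _ _ r _ _ _ f).
Qed.

Lemma f_class_reads_class (w : V) : @f_class (sem V) eps I (code_of c) w ->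
  reads_class r w (fun a b f => smem (rmor r f) w).
Proof.
case=> wI wP; split; first exact/is_setE.
move=> x; split=> [xw|[a [b [f [fw ->]]]]//].
case/(ex_obE eps_I): (wP x xw) => y /(reads_obj r)[a ->].
case/(ex_obE eps_I) => z /(reads_obj r)[b ->].
case/(ex_homE eps_I) => f /(reads_hom_ex)[f' ->] e.
by exists a, b, f'; rewrite -e.
Qed.
End Classes.
End Encoding.

(** * Transfer *)

Section Readings.
Variables (S : Type) (V : superstructure S) (u eps : V).
Local Notation I := (individuals V).
Hypothesis eps_I : forall x y, related eps x y -> smem x I.
Local Notation logic_of c := (@code_clogic (sem V) eps I (code_of c)).
Variables (m : model_code V) (M : category) (W F C : mor_class M).
Variable r : model_reads u eps m W F C.

(** Used in both directions: in V to recognize an arbitrary code as a small model category, in V' to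
    feed the external model category [M] into the transferred statement. *)
Lemma model_reads_f_model :
  @f_model (sem V) (logic_of (m_cat m)) (fun _ _ x => smem x (m_W m))
    (fun _ _ x => smem x (m_F m)) (fun _ _ x => smem x (m_C m))
  <-> is_model_category W F C.
Proof.
rewrite -(f_model_cat V); apply: (i_model (i := reads_interpretation eps_I r));
  move=> a b f; apply: reads_class_mem; [exact: mr_W|exact: mr_F|exact: mr_C].
Qed.

Lemma model_reads_loc_like (c : category_code V) (L : category)
    (rL : reads u eps c L) (g0 g1 : V) (G : functor M L) :
  reads_graphs r rL g0 g1 G ->
  @f_loc_like (sem V) (logic_of (m_cat m)) (logic_of c)
    (fun _ _ x => smem x (m_W m)) (fun _ _ x => smem x (m_F m))
    (fun _ _ x => smem x (m_C m)) (@f_related (sem V) g0)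
    (fun _ _ _ _ => @f_related (sem V) g1)
  <-> loc_like W F C G.
Proof.
move=> gP; rewrite -(f_loc_like_cat V).
apply: (i_loc_like (i := reads_interpretation eps_I r)
  (j := reads_interpretation eps_I rL)).
- by move=> a b f; apply: reads_class_mem (mr_W r).
- by move=> a b f; apply: reads_class_mem (mr_F r).
- by move=> a b f; apply: reads_class_mem (mr_C r).
- move=> a x; rewrite f_relatedE (reads_graph0 _ _ gP).
  by split=> [/(@rob_inj _ _ _ _ _ _ rL)|->].
- move=> a b x y f f'; rewrite f_relatedE (reads_graph1 _ _ gP).
  exact: rmor_arr.
Qed.
End Readings.

Section Homotopy.
Variables (S : Type) (V : superstructure S) (u eps Ho : V).
Local Notation I := (individuals V).
Hypothesis eps_I : forall x y, related eps x y -> smem x I.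
Hypothesis HoP : is_homotopy_function u eps Ho.

Definition stage (n : nat) : V := subset_of n (fun=> True).

Lemma smem_stage n x : smem x (stage n) <->
  in_stage (@smem S V) (@atom S V) n x.
Proof. by rewrite subset_ofP; split=> [[]|]. Qed.

(** Stages are transitive, so everything that occurs in an element of [Ho], including the components
    of its pairs and tuples, lies in the stage of [Ho]; [stage n] can bound all witnesses. *)
Lemma homotopy_function_f_homotopy n :
  in_stage (@smem S V) (@atom S V) n Ho ->
  @f_homotopy (sem V) u eps I Ho (stage n).
Proof.
move=> Hon o _ a _ s _ t _ i _ k _ w _ f _ c _.
move=> m0 K0 [cP [[wP [fP cP']] modelP]].
pose cc := @CategoryCode _ V o a s t i k.
have r : reads u eps cc (decoded eps_I (c := cc) cP) by apply: decoded_reads.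
pose m := ModelCode cc w f c.
have rM := @ModelReads _ _ u eps m _ _ _ _ r (f_class_reads_class eps_I r wP)
  (f_class_reads_class eps_I r fP) (f_class_reads_class eps_I r cP').
have hM := (model_reads_f_model eps_I rM).1 modelP.
have [zc zcP] := tuple_exists o [:: a; s; t; i; k].
have [zm zmP] := tuple_exists zc [:: w; f; c].
have [_ Ho_val Ho_tot] := HoP.
have [|v [[z zHo zP] _]] := Ho_tot zm.
  by exists m, _, _, _, _, rM; split=> //; exists zc.
have [zm' [v' [zP' val]]] := Ho_val z zHo.
have [ezm ev] := pair_inj zP' zP; rewrite {}ezm {}ev in val => {zm' v' zP'}.
case: val => m' [M' [W' [F' [C' [rM' [[zc' zcP' zmP'] hM' val]]]]]].
(* The value of [Ho] comes with its own reading [M'] of the same tuple. Only the codes are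
   identified; the formulas then do not depend on which reading is used. *)
have mm : m' = m.
  case: m' zcP' zmP' {rM' val} => [[o' a' s' t' i' k'] w' f' c'] zcP' zmP'.
  case: (@tuple_inj _ _ zm _ _ [:: _; _; _] [:: _; _; _] (erefl 3) zmP' zmP).
  move=> /= ezc -> -> ->; rewrite ezc in zcP'.
  case: (@tuple_inj _ _ zc _ _ [:: _; _; _; _; _] [:: _; _; _; _;
    _] (erefl 5) zcP' zcP).
  by move=> /= -> -> -> -> -> ->.
rewrite {}mm /= in rM' zcP' zmP' val => {m'}.
case: val => zl [g [cl [L [rL [gamma [Phi [zlP vP gP iso PhiE]]]]]]].
case: gP => g0 [g1 [gP g0P g1P]].
have graphs : reads_graphs rM' rL g0 g1 gamma by [].
have like : loc_like W' F' C' gamma by rewrite -PhiE; apply: loc_like_comp.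
have zn := in_stage_smem Hon zHo; have [zmn vn] := in_stage_pair zn zP.
have [zln gn] := in_stage_pair vn vP.
have zcn : in_stage (@smem S V) (@atom S V) n zc.
  by apply: in_stage_tuple zmn zmP _ _; left.
have zlc := in_stage_tuple zln zlP.
have [g0n g1n] := in_stage_pair gn gP.
exists zm; first exact/smem_stage.
exists v; first exact/smem_stage.
exists zl; first exact/smem_stage.
exists g; first exact/smem_stage.
exists (c_obj cl); first by apply/smem_stage/zlc; left.
exists (c_mor cl); first by apply/smem_stage/zlc; right; left.
exists (c_src cl); first by apply/smem_stage/zlc; do 2!right; left.
exists (c_tgt cl); first by apply/smem_stage/zlc; do 3!right; left.
exists (c_id cl); first by apply/smem_stage/zlc; do 4!right; left.
exists (c_comp cl); first by apply/smem_stage/zlc; do 5!right; left.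
exists g0; first exact/smem_stage.
exists g1; first exact/smem_stage.
exists zc; first exact/smem_stage.
split; first exact/f_tupleE.
split; first exact/f_tupleE.
split; first by apply/f_relatedE; exists z.
split; first exact/f_pairE.
split; first exact/f_tupleE.
split; first exact/f_pairE.
split; first exact: (reads_category eps_I rL).
split; first exact: (reads_graphs_functor eps_I graphs).
exact/(model_reads_loc_like eps_I graphs).
Qed.
End Homotopy.

Section Transfer.
Variables (S S' : Type) (V : superstructure S) (V' : superstructure S').
Variable star : V -> V'.
Hypothesis enl : is_enlargement star.

Lemma transfer_subset (A B : V) : (forall x, smem x A -> smem x B) ->
  forall x, smem x (star A) -> smem x (star B).
Proof.
pose p := @Fall syn (free_var 0) (fun x => @Fmem syn x (free_var 1)).
exact: (star_transfer enl (p 0) (fun i => if i is 0 then A else B)).1.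
Qed.

(** A bounded form of the hypothesis [eps_I], by which it passes from V to V'. *)
Definition f_pairs_over (L : logic) (r I : tm L) : fm L :=
  Fall r (fun z => Fex I (fun x => Fex I (fun y => f_pair z x y))).

Lemma pairs_over_related (T : Type) (X : superstructure T) (r x y : X) :
  @f_pairs_over (sem X) r (individuals X) -> related r x y ->
  smem x (individuals X).
Proof.
move=> rP [z zr zP]; have [x' x'I [y' _ /f_pairE zP']] := rP z zr.
by have [-> _] := pair_inj zP zP'.
Qed.

Lemma transfer_pairs_over (r I : V) :
  @f_pairs_over (sem V) r I -> @f_pairs_over (sem V') (star r) (star I).
Proof.
exact: (star_transfer enl (@f_pairs_over syn (free_var 0) (free_var 1) 0)
  (fun i => if i is 0 then r else I)).1.
Qed.

(** A set [A] of V is contained in some stage, and the inclusion transfers. Internal data are thus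
    covered by the images of the stages. *)
Lemma internal_stage x : internal star x ->
  exists n, forall m, n <= m -> smem x (star (stage V m)).
Proof.
case=> A xA; have [n An] := sset_stage A; exists n => m nm.
apply: (transfer_subset _ xA) => y yA; apply/smem_stage.
exact: in_stage_leq nm (in_stage_smem An yA).
Qed.

Lemma internal_stages (xs : seq V') : (forall x, List.In x xs ->
  internal star x) ->
  exists n, forall m, n <= m -> forall x, List.In x xs ->
    smem x (star (stage V m)).
Proof.
elim: xs => [|x xs IH] xs_int; first by exists 0.
have [n nP] := internal_stage (xs_int x (or_introl erefl)).
have [|n' n'P] := IH; first by move=> y yxs; apply: xs_int; right.
exists (maxn n n') => m; rewrite geq_max => /andP[nm n'm] y [<-|];
  first exact: nP.
exact: n'P.
Qed.
End Transfer.

Lemma univ_mem_rel_pairs (U : universe_hierarchy) (S : Type)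
    (V : superstructure S) (inj : U -> S) :
  @f_pairs_over (sem V) (univ_mem_rel V inj) (individuals V).
Proof.
move=> z /subset_ofP[_ [t [w [_ zP]]]].
exists (atom V (inj t)); first by apply/subset_ofP; split=> //; exists (inj t).
exists (atom V (inj w)); first by apply/subset_ofP; split=> //; exists (inj w).
exact/f_pairE.
Qed.

Theorem theorem3p5
  (U : universe_hierarchy) (S S' : Type) (inj : U -> S) (inj_inj : injective inj)
  (V : superstructure S) (V' : superstructure S') (star : V -> V')
  (star_enl : is_enlargement star)
  (Ho : V)
  (HoP : is_homotopy_function (univ_set V inj 1) (univ_mem_rel V inj) Ho)
  (m : model_code V') (M : category) (W F C : mor_class M)
  (rM : model_reads (star (univ_set V inj 1)) (star (univ_mem_rel V inj)) m W F C)
  (M_internal : is_internal_model_category rM) :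
  exists (zm v zl g : V') (cl : category_code V') (L : category)
    (rL : reads (star (univ_set V inj 1)) (star (univ_mem_rel V inj)) cl L)
    (starQ : functor M L),
  [/\ model_tuple zm m,
      related (star Ho) zm v,
      is_pair v zl g /\ category_tuple zl cl,
      reads_functor rM rL g starQ &
      exists Phi : functor (localization W) L,
        functor_iso Phi /\ functor_comp Phi (loc_functor W) = starQ].
Proof.
set u := univ_set V inj 1; set eps := univ_mem_rel V inj.
have epsP := @univ_mem_rel_pairs U S V inj.
have eps_I x y : related eps x y -> smem x (individuals V).
  exact: pairs_over_related epsP.
have eps_I' x y : related (star eps) x y -> smem x (individuals V').
  apply: pairs_over_related; rewrite -(star_individuals star_enl).
  exact: transfer_pairs_over epsP.
case: M_internal => hM [s_int t_int i_int k_int] [W_int F_int C_int].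
have [ou au] := reads_small rM.
pose c := m_cat m.
have [n0 n0P] : exists n, forall k, n <= k -> forall x, List.In x
    [:: c_obj c; c_mor c; c_src c; c_tgt c; c_id c; c_comp c; m_W m; m_F m;
      m_C m] ->
    smem x (star (stage V k)).
  apply: (internal_stages star_enl) => x.
  do !case=> [<- //|]; try by [].
  (* The sets of objects and of morphisms are internal as elements of [star u]. *)
  - by exists u.
  - by exists u.
have [n1 Hon1] := sset_stage Ho.
(* The stage has two tasks: its image must contain the nine components of the code of [M], and the
   stage itself must contain [Ho]. *)
pose n := maxn n0 n1.
have Hon := in_stage_leq (leq_maxr n0 n1) Hon1.
have inB := n0P n (leq_maxl _ _).
have := transfer_homotopy star_enl (homotopy_function_f_homotopy eps_I HoP Hon).
rewrite (star_individuals star_enl) -/n => starHo.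
have [zm _ [v _ [zl _ [g _ [o' _ [a' _ [s' _ [t' _ [i' _ [k' _
    [g0 _ [g1 _ [zc _]]]]]]]]]]]]] := starHo
  (c_obj c) (inB _ (or_introl erefl))
  (c_mor c) (inB _ (or_intror (or_introl erefl)))
  (c_src c) (inB _ (or_intror (or_intror (or_introl erefl))))
  (c_tgt c) (inB _ (ltac:(do 3!right; by left)))
  (c_id c) (inB _ (ltac:(do 4!right; by left)))
  (c_comp c) (inB _ (ltac:(do 5!right; by left)))
  (m_W m) (inB _ (ltac:(do 6!right; by left)))
  (m_F m) (inB _ (ltac:(do 7!right; by left)))
  (m_C m) (inB _ (ltac:(do 8!right; by left)))
  (conj (reads_category eps_I' rM) (conj (conj
    (reads_class_f_class eps_I' (mr_W rM)) (conj
    (reads_class_f_class eps_I' (mr_F rM))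
    (reads_class_f_class eps_I' (mr_C rM))))
    ((model_reads_f_model eps_I' rM).2 hM))).
case=> /f_tupleE zcP [/f_tupleE zmP [/f_relatedE zmv [/f_pairE vP]]].
case=> /f_tupleE zlP [/f_pairE gP [lP [funP like]]].
pose cl := @CategoryCode _ V' o' a' s' t' i' k'.
(* The value of the extended function is known only through formulas; decoding turns it into an
   external category. *)
have rL : reads (star u) (star eps) cl (decoded eps_I' (c := cl) lP).
  exact: decoded_reads.
have [starQ graphs] := functor_reads_graphs eps_I' rM rL funP.
exists zm, v, zl, g, cl, _, rL, starQ; split=> //.
- by exists zc.
- by exists g0, g1; case: graphs.
(* Here the transferred clauses are read externally: the words in [localization W] have ordinary
   finite length. *)
- exact/(loc_like_iso hM)/(model_reads_loc_like eps_I' graphs).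
Qed.
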